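(* For $\omega\in(0,\frac{\pi}{2})$ let $$\mathfrak{c}_1=\frac12-\frac{\omega}{\pi},\qquad \mathfrak{c}_2=\frac{\cot\omega}{\pi-2\omega},$$ and for $n\in\mathbb{N}$ with $n\mathfrak{c}_1>1$ let $$\mu_n=-\sqrt{\frac{\log(n\mathfrak{c}_1)}{\mathfrak{c}_2}},\qquad \sigma_n^2=\frac{-\log\log2}{2\mathfrak{c}_2\bigl(\log(n\mathfrak{c}_1)-\log\log2\bigr)} .$$ Then for any $\omega\in(0,\frac\pi2)$ there exists $\widetilde n(\omega)\in\mathbb{N}$ (large enough that these quantities are defined for all $n\ge\widetilde n(\omega)$) such that for all $n\ge\widetilde n(\omega)$, all $m\in\{1,\dots,n\}$, all $\rho\in(0,1]$ and all $\alpha\in(0,1]$, $$p_{\mathrm{success}}^{\mathcal{NC}(\rho)}(n,m,\alpha)\ \ge\ p_{\mathrm{success}}^{\mathcal{NC}(\rho)}(n,1,\alpha)\ \ge\ \Phi\!\left(\frac{\Phi^{-1}(\alpha)-\rho\mu_n}{\sqrt{1-\rho^2+\rho^2\sigma_n^2}}\right).$$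
   Context: $\log$ is the natural logarithm. $\Phi$ and $\Phi^{-1}$ are the standard Gaussian CDF and quantile function, with the conventions $\Phi^{-1}(1)=+\infty$, $\Phi(+\infty)=1$. Success probability. Let $(Z,X)$ be a pair of real random variables with continuous joint distribution, and let $(Z_1,X_1),\dots,(Z_n,X_n)$ be i.i.d. copies. Order the $Z$-values as $Z_{1:n}\le\dots\le Z_{n:n}$ (ties have probability zero) and let $X_{\langle i\rangle}$ be the $X$-value attached to $Z_{i:n}$, i.e. $X_{\langle i\rangle}=X_k$ when $Z_{i:n}=Z_k$. For $1\le m\le n$ and $\alpha\in(0,1]$, $$p_{\mathrm{success}}(n,m,\alpha):=\Pr\Bigl(\min_{1\le i\le m}X_{\langle i\rangle}\le x_\alpha^*\Bigr),$$ where $x_\alpha^*$ is such that $\Pr(X\le x_\alpha^* )=\alpha$ (with $x_1^*=+\infty$ allowed). This quantity depends on the law of $(Z,X)$ only through its copula (the joint distribution of $(F_Z(Z),F_X(X))$, where $F_Z,F_X$ are the marginal CDFs). Gaussian copula. $\mathcal{NC}(\rho)$ denotes the bivariate Gaussian copula with correlation $\rho$: the distribution of $(\Phi(G_1),\Phi(G_2))$, where $(G_1,G_2)$ is bivariate Gaussian with zero means, unit variances and correlation $\rho$. $p_{\mathrm{success}}^{\mathcal{NC}(\rho)}(n,m,\alpha)$ denotes the success probability when $(Z,X)$ has copula $\mathcal{NC}(\rho)$. *)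

(* Defs.v *)
From mathcomp Require Import all_boot all_order all_algebra.
From mathcomp Require Import all_classical all_reals all_analysis.

Set Implicit Arguments.
Unset Strict Implicit.
Unset Printing Implicit Defensive.
Import Order.TTheory GRing.Theory Num.Theory.
Import numFieldNormedType.Exports.
Local Open Scope classical_set_scope.
Local Open Scope ring_scope.

(* One definition on the extended line covers Phi(+oo) = 1. *)
Definition Phi (R : realType) (x : \bar R) : R :=
  fine (normal_prob 0 1 [set t : R | (t%:E <= x)%E]).

(* Generalized inverse; at 1 the set is empty and the infimum is +oo. *)
Definition PhiInv (R : realType) (p : R) : \bar R :=
  ereal_inf (EFin @` [set x : R | p <= Phi x%:E]).

(* Law of (G1, G2), obtained from independent standard Gaussians (U, V) as
   (U, rho U + sqrt (1 - rho^2) V); this includes the degenerate case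
   rho = 1, where there is no density. *)
Definition bigaussian (R : realType) (rho : R) : set (R * R) -> \bar R :=
  pushforward (normal_prob (0 : R) 1 \x normal_prob (0 : R) 1)%E
    (fun u : R * R => (u.1, rho * u.1 + Num.sqrt (1 - rho ^+ 2) * u.2)).

Definition gaussian_copula (R : realType) (rho : R) : set (R * R) -> \bar R :=
  pushforward (bigaussian rho)
    (fun g : R * R => (Phi g.1%:E, Phi g.2%:E)).

Section SuccessProbability.
Context d (T : measurableType d) (R : realType) (P : probability T R).

Definition continuous_joint_cdf (Z X : {RV P >-> R}) : Prop :=
  continuous (fun p : R * R =>
    fine (P [set w | Z w <= p.1 /\ X w <= p.2])).

Definition has_copula (Z X : {RV P >-> R}) (C : set (R * R) -> \bar R) : Prop :=
  forall A : set (R * R), measurable A ->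
    P [set w | A (fine (cdf Z (Z w)), fine (cdf X (X w)))] = C A.

Definition iid_copies (Z X : {RV P >-> R}) (n : nat)
    (Zs Xs : 'I_n -> {RV P >-> R}) : Prop :=
  (forall (i : 'I_n) (A : set (R * R)), measurable A ->
     P [set w | A (Zs i w, Xs i w)] = P [set w | A (Z w, X w)]) /\
  (forall (J : {set 'I_n}) (A : 'I_n -> set (R * R)),
     (forall i, measurable (A i)) ->
     P [set w | forall i, i \in J -> A i (Zs i w, Xs i w)] =
     (\prod_(i in J) P [set w | A i (Zs i w, Xs i w)])%E).

Definition z_order (n : nat) (Zs : 'I_n -> {RV P >-> R}) (w : T) : seq 'I_n :=
  sort (fun j k => Zs j w <= Zs k w) (enum 'I_n).

(* The X-value attached to the (i+1)-th smallest Z-value, for i < n. *)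
Definition concomitant (n : nat) (Zs Xs : 'I_n -> {RV P >-> R}) (i : nat)
    (w : T) : R :=
  nth 0 [seq Xs k w | k <- z_order Zs w] i.

Definition p_success (n : nat) (Zs Xs : 'I_n -> {RV P >-> R}) (m : nat)
    (xstar : \bar R) : \bar R :=
  P [set w |
     (\big[Order.min/+oo]_(i < m) (concomitant Zs Xs i w)%:E <= xstar)%E].

End SuccessProbability.

Definition c1 (R : realType) (omega : R) : R := 1 / 2 - omega / pi.

Definition c2 (R : realType) (omega : R) : R :=
  (cos omega / sin omega) / (pi - 2 * omega).

Definition mu_ (R : realType) (omega : R) (n : nat) : R :=
  - Num.sqrt (ln (n%:R * c1 omega) / c2 omega).

Definition sigma2_ (R : realType) (omega : R) (n : nat) : R :=
  - ln (ln 2) / (2 * c2 omega * (ln (n%:R * c1 omega) - ln (ln 2))).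

(* Main.v *)
Require Import Defs.
From mathcomp Require Import all_boot all_order all_algebra.
From mathcomp Require Import all_classical all_reals all_analysis.
From mathcomp Require Import measurable_realfun ring lra.
Import Order.TTheory GRing.Theory Num.Theory.
Import numFieldNormedType.Exports.
Local Open Scope classical_set_scope.
Local Open Scope ring_scope.

Set Implicit Arguments.
Unset Strict Implicit.

(* For m = 1 the success probability is P(rho M + sqrt(1 - rho^2) V <= q), where
   M is the minimum of n standard Gaussians, V is an independent one and
   Phi q = alpha.  The bound follows once M is stochastically dominated by
   N(mu_n, sigma_n^2), that is
     Phi(s)^n <= Phi((s + mu_n) / sigma_n)   for all real s,
   because a Gaussian mixture of Gaussians is Gaussian.  Craig's formula and
   Jensen's inequality give 1 - Phi(s) >= c1 exp(-c2 s^2), hence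
   Phi(s)^n <= exp(-exp(ln(n c1) - c2 s^2)) for s >= 0.  In the variable
   t = 2 c2 a (s - a), a = -mu_n, this is a Gumbel-like function which is compared
   with the Gaussian on each side of a; the constant ln (ln 2) makes the comparison
   exact on the right, and on the left n has to be large.  The law of M never
   appears: the value of F_Z at the minimum is discretized on a grid of mesh 1/N,
   independence is used on each cell, and N tends to infinity. *)

(** * The Gaussian distribution function *)

Import HBNNSimple.

(** First of three stages, from indicators through nonnegative simple functions to monotone limits,
    that turn an integral against [normal_prob] into a Lebesgue integral with a density. *)
Lemma integral_normal_indic (R : realType) (m s : R) (E : set R) :
  measurable E ->
  (\int[normal_prob m s]_x (\1_E x)%:E =
   \int[lebesgue_measure]_x ((\1_E x)%:E * (normal_pdf m s x)%:E))%E.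
Proof.
move=> mE; rewrite integral_indic//= setIT /normal_prob [LHS]integral_mkcond/=.
apply: eq_integral => x _; rewrite patchE indicE.
by case: (x \in E); rewrite ?mul1e ?mul0e.
Qed.

Lemma integral_normal_nnsfun (R : realType) (m s : R)
    (f : {nnsfun measurableTypeR R >-> R}) :
  (\int[normal_prob m s]_x (f x)%:E =
   \int[lebesgue_measure]_x ((f x)%:E * (normal_pdf m s x)%:E))%E.
Proof.
have mp : measurable_fun setT (fun x : R => (normal_pdf m s x)%:E).
  apply/measurable_EFinP; exact: measurable_normal_pdf.
under [LHS]eq_integral do rewrite fimfunE -fsumEFin//.
rewrite [LHS]ge0_integral_fsum//; last 2 first.
- by move=> r; exact/measurable_EFinP/measurableT_comp.
- by move=> n x _; rewrite EFinM nnfun_muleindic_ge0.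
under [RHS]eq_integral.
  move=> x xD; rewrite fimfunE -fsumEFin// ge0_mule_fsuml; last first.
    by move=> r; rewrite EFinM nnfun_muleindic_ge0.
  over.
rewrite [RHS]ge0_integral_fsum//; last 2 first.
- move=> r; apply: emeasurable_funM => //.
  by apply/measurable_EFinP/measurable_funM => //; exact: measurable_indic.
- move=> n x _; rewrite mule_ge0//; last by rewrite lee_fin normal_pdf_ge0.
  by rewrite EFinM nnfun_muleindic_ge0.
apply: eq_fsbigr => r _.
(* A nonnegative simple function has an empty preimage at a negative value, so both integrals
   vanish. *)
have [r0|r0] := leP 0 r; last first.
  rewrite !integral0_eq// => x _; rewrite preimage_nnfun0// indic0 mulr0//.
  by rewrite mul0e.
under [RHS]eq_integral do rewrite EFinM -muleA.
rewrite integralZl_indic_nnsfun// integral_normal_indic//.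
rewrite ge0_integralZl//.
- by apply: emeasurable_funM => //; exact/measurable_EFinP/measurable_indic.
- by move=> x _; rewrite mule_ge0// lee_fin ?normal_pdf_ge0.
- have /(_ _ (measurable_set1 r)) := measurable_funPT f measurableT.
  by rewrite setTI.
Qed.

Lemma integral_normal_prob (R : realType) (m s : R)
    (f : measurableTypeR R -> \bar R) :
  measurable_fun setT f -> (forall x, 0 <= f x)%E ->
  (\int[normal_prob m s]_x f x =
   \int[lebesgue_measure]_x (f x * (normal_pdf m s x)%:E))%E.
Proof.
move=> mf f0; pose f_ := nnsfun_approx measurableT mf.
have mp : measurable_fun setT (fun x : R => (normal_pdf m s x)%:E).
  apply/measurable_EFinP; exact: measurable_normal_pdf.
transitivity (lim (\int[normal_prob m s]_x (f_ n x)%:E @[n --> \oo])%E).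
  rewrite -monotone_convergence//=.
  - apply: eq_integral => ? _; apply/esym/cvg_lim => //=.
    exact: cvg_nnsfun_approx.
  - by move=> n; exact/measurable_EFinP/measurable_funTS.
  - by move=> n ? _; rewrite lee_fin.
  - by move=> ? _ ? ? ?; rewrite lee_fin; exact/lefP/nd_nnsfun_approx.
under eq_fun do rewrite integral_normal_nnsfun.
rewrite -monotone_convergence//=.
- apply: eq_integral => x _; apply/cvg_lim => //=.
  by apply: cvgeZr => //; exact: cvg_nnsfun_approx.
- move=> n; apply: emeasurable_funM => //.
  exact/measurable_EFinP/measurable_funTS.
- by move=> n x _; rewrite mule_ge0// lee_fin ?normal_pdf_ge0.
- move=> x _ i j ij; rewrite lee_wpmul2r ?lee_fin ?normal_pdf_ge0//.
  exact/lefP/nd_nnsfun_approx.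
Qed.

Lemma normal_pdf_std (R : realType) (m s x : R) : 0 < s ->
  normal_pdf m s x = normal_pdf 0 1 ((x - m) / s) / s.
Proof.
move=> s0; rewrite !normal_pdfE ?gt_eqF// /normal_peak /normal_fun subr0.
rewrite expr1n mul1r -mulrnAr sqrtrM ?sqr_ge0// sqrtr_sqr gtr0_norm// invfM.
rewrite [RHS]mulrC mulrA; congr (_ * expR _).
by rewrite exprMn exprVn; field; rewrite gt_eqF.
Qed.

Lemma normal_pdf01E (R : realType) (x : R) :
  normal_pdf 0 1 x = (Num.sqrt (pi *+ 2))^-1 * expR (- x ^+ 2 / 2).
Proof.
by rewrite normal_pdfE ?oner_eq0// /normal_peak /normal_fun subr0 expr1n mul1r.
Qed.

Lemma normal_prob_std (R : realType) (m s x : R) : 0 < s ->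
  normal_prob m s `]-oo, x] = normal_prob 0 1 `]-oo, (x - m) / s].
Proof.
move=> s0; rewrite /normal_prob.
pose F (y : R) := (y - m) / s.
have dF : F^`()%classic = cst s^-1.
  apply/funext => y; rewrite /F derive1E deriveM// deriveD// derive_cst scaler0.
  by rewrite add0r derive_id derive_cst addr0 scaler1.
rewrite (@increasing_ge0_integration_by_substitutionNy _ F)//.
- apply: eq_integral => y _; rewrite dF/= /F fctE/=.
  by rewrite normal_pdf_std.
- by move=> y z _ _ yz; rewrite /F ltr_pM2r ?invr_gt0// ltrD2r.
- by rewrite dF => ? _; exact: cvg_cst.
- by rewrite dF; exact: is_cvg_cst.
- by rewrite dF; exact: cvg_cst.
- split; first by move=> y _; rewrite /F.
  apply: cvg_at_left_filter; apply: cvgM; last exact: cvg_cst.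
  by apply: (@cvgB _ R^o) => //; exact: cvg_cst.
- apply/gt0_cvgMlNy; last exact: cvg_addrr_Ny.
  by rewrite invr_gt0.
- apply: continuous_subspaceT; apply: continuous_normal_pdf.
  by rewrite oner_eq0.
- by move=> y _; exact: normal_pdf_ge0.
Qed.

Lemma PhiE (R : realType) (x : R) :
  (Phi x%:E)%:E = normal_prob 0 1 `]-oo, x].
Proof.
rewrite /Phi (_ : [set t | _] = `]-oo, x]%classic); last first.
  by apply/seteqP; split => t /=; rewrite in_itv/= lee_fin.
by rewrite fineK// fin_num_measure.
Qed.

Lemma Phi_normal (R : realType) (m s x : R) : 0 < s ->
  normal_prob m s `]-oo, x] = (Phi ((x - m) / s)%:E)%:E.
Proof. by move=> s0; rewrite PhiE normal_prob_std. Qed.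

Lemma Phi_ge0 (R : realType) (x : \bar R) : 0 <= Phi x.
Proof. by rewrite /Phi fine_ge0. Qed.

Lemma Phi_le1 (R : realType) (x : R) : Phi x%:E <= 1.
Proof. by rewrite -lee_fin PhiE probability_le1. Qed.

Lemma Phi_pinfty (R : realType) : Phi (+oo : \bar R)%E = 1.
Proof.
rewrite /Phi (_ : [set t | _] = setT); last first.
  by apply/seteqP; split => t //= _; rewrite leey.
by rewrite probability_setT.
Qed.

Lemma Phi_compl (R : realType) (x : R) :
  normal_prob 0 1 `]x, +oo[ = (1 - Phi x%:E)%:E.
Proof.
rewrite EFinB PhiE -(@probability_setT _ _ _ (normal_prob (0 : R) 1)).
rewrite -setCitvl probability_setC//.
by rewrite -(@probability_setT _ _ _ (normal_prob (0 : R) 1)).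
Qed.

Lemma normal_prob_set1 (R : realType) (x : R) : normal_prob 0 1 [set x] = 0%E.
Proof.
apply: null_set_integral => //; last exact: lebesgue_measure_set1.
by apply/measurable_EFinP; apply/measurable_funTS; exact: measurable_normal_pdf.
Qed.

Lemma normal_pdf01N (R : realType) (x : R) :
  normal_pdf 0 1 (- x) = normal_pdf 0 1 x.
Proof. by rewrite !normal_pdf01E sqrrN. Qed.

(** The closed half-line is what reflection produces in [PhiN]; its endpoint is a null set. *)
Lemma Phi_compl_closed (R : realType) (x : R) :
  normal_prob 0 1 `[x, +oo[ = (1 - Phi x%:E)%:E.
Proof.
rewrite -(@setU1itv _ _ +oo%O x false)// measureU//=.
  by rewrite normal_prob_set1 add0e -Phi_compl.
by apply/seteqP; split => y//= [->]; rewrite in_itv/= ltxx.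
Qed.

Lemma PhiN (R : realType) (x : R) : Phi (- x)%:E = 1 - Phi x%:E.
Proof.
apply: EFin_inj; rewrite PhiE -Phi_compl_closed.
rewrite /normal_prob ge0_integration_by_substitutionNy.
- by apply: eq_integral => y _; rewrite /= normal_pdf01N.
- apply: continuous_subspaceT; apply: continuous_normal_pdf.
  by rewrite oner_eq0.
- by move=> y _; exact: normal_pdf_ge0.
Qed.

Lemma Phi0 (R : realType) : Phi 0%:E = 1 / 2 :> R.
Proof. by have := PhiN (0 : R); rewrite oppr0 => ?; lra. Qed.

Lemma Phi_mono (R : realType) (x y : R) : x <= y -> Phi x%:E <= Phi y%:E.
Proof.
move=> xy; rewrite -lee_fin !PhiE le_measure ?inE//.
by apply: subset_itvl; rewrite bnd_simp.
Qed.

Lemma is_derive_Phi (R : realType) (x : R) :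
  is_derive x 1 (fun x : R => Phi x%:E) (normal_pdf 0 1 x).
Proof.
have -> : (fun x : R => Phi x%:E) =
    (fun x => \int[lebesgue_measure]_(t in `]-oo, x]) normal_pdf 0 1 t).
  by apply/funext => y; rewrite -[LHS]/(fine (Phi y%:E)%:E) PhiE.
have [||||d1 d2] := @continuous_FTC1 R (normal_pdf 0 1) -oo%O x (x + 1).
- by rewrite ltrDl.
- by apply: (integrableS measurableT) => //; exact: integrable_normal_pdf.
- exact: ltNyr.
- by apply: continuous_normal_pdf; rewrite oner_eq0.
- by apply: DeriveDef; [exact: d1|rewrite -derive1E; exact: d2].
Qed.

Lemma continuous_Phi (R : realType) : continuous (fun x : R => Phi x%:E).
Proof.
move=> x; apply: differentiable_continuous; apply/derivable1_diffP.
by have [] := is_derive_Phi x.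
Qed.

Lemma normal_pdf01_gt0 (R : realType) (x : R) : 0 < normal_pdf 0 1 x.
Proof.
by rewrite normal_pdf01E mulr_gt0 ?expR_gt0// invr_gt0 sqrtr_gt0 pmulrn_lgt0
  ?pi_gt0.
Qed.

Lemma Phi_lt (R : realType) (x y : R) : x < y -> Phi x%:E < Phi y%:E.
Proof.
move=> xy.
have [z _ e] := @MVT _ (fun x : R => Phi x%:E) (normal_pdf 0 1) x y xy
  (fun z _ => is_derive_Phi z) (continuous_subspaceT (@continuous_Phi R)).
by rewrite -subr_gt0 e mulr_gt0 ?normal_pdf01_gt0// subr_gt0.
Qed.

Lemma Phi_lt1 (R : realType) (x : R) : Phi x%:E < 1.
Proof. by apply: lt_le_trans (Phi_le1 (x + 1)); rewrite Phi_lt// ltrDl. Qed.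

Lemma Phi_gt0 (R : realType) (x : R) : 0 < Phi x%:E.
Proof.
by apply: le_lt_trans (Phi_ge0 (x - 1)%:E) _; rewrite Phi_lt// gtrDl oppr_lt0.
Qed.

(** [Phi (- z)] is the mass that the normal law centred at [z] gives to the negative half-line.
    There [(x - z)^2 >= x^2 + z^2], so its density is at most [expR (- z ^+ 2 / 2)] times the
    standard one, whose mass there is 1/2. *)
Lemma PhiN_le (R : realType) (z : R) : 0 <= z ->
  Phi (- z)%:E <= expR (- z ^+ 2 / 2) / 2.
Proof.
move=> z0.
have := @Phi_normal R z 1 0 ltr01; rewrite sub0r divr1 => H.
rewrite -lee_fin -H EFinM -[X in (_ * X)%E]/((2^-1)%:E).
have <- : normal_prob (0 : R) 1 `]-oo, 0] = (2^-1)%:E.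
  by rewrite -PhiE Phi0 mul1r.
rewrite /normal_prob -ge0_integralZl//=; last 2 first.
- apply/measurable_EFinP; apply/measurable_funTS; exact: measurable_normal_pdf.
- by move=> x _; rewrite lee_fin normal_pdf_ge0.
apply: ge0_le_integral => //=.
- by move=> x _; rewrite lee_fin normal_pdf_ge0.
- apply/measurable_EFinP; apply/measurable_funTS; exact: measurable_normal_pdf.
- apply/measurable_EFinP; apply/measurable_funTS; apply: measurable_funM => //.
  exact: measurable_normal_pdf.
move=> x; rewrite in_itv/= => x0.
rewrite lee_fin normal_pdf_std// divr1 !normal_pdf01E divr1.
rewrite mulrCA ler_wpM2l ?invr_ge0// -expRD ler_expR.
by have := mulr_le0_ge0 x0 z0; nra.
Qed.

Lemma normal_peak01_le (R : realType) : (Num.sqrt (pi *+ 2))^-1 <= 1 / 2 :> R.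
Proof.
have p4 : 2 ^+ 2 <= pi *+ 2 :> R by have := pi_ge2 R; lra.
have p0 : 0 < pi *+ 2 :> R by apply: lt_le_trans p4; rewrite exprn_gt0.
rewrite mul1r lef_pV2 ?posrE ?sqrtr_gt0//.
by rewrite -[X in X <= _](@ger0_norm R)// -sqrtr_sqr ler_wsqrtr.
Qed.

(** Mean value theorem on [[0, z]], the density being at most 1/2. *)
Lemma PhiN_ge (R : realType) (z : R) : 0 <= z -> 1 / 2 - z / 2 <= Phi (- z)%:E.
Proof.
rewrite le_eqVlt => /predU1P[<-|z0]; first by rewrite oppr0 Phi0; lra.
have [y _ e] := @MVT _ (fun x : R => Phi x%:E) (normal_pdf 0 1) 0 z z0
  (fun y _ => is_derive_Phi y) (continuous_subspaceT (@continuous_Phi R)).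
rewrite PhiN; suff: Phi z%:E - Phi 0%:E <= z / 2 by rewrite Phi0; lra.
rewrite e subr0 mulrC; apply: ler_wpM2l; first exact: ltW.
rewrite normal_pdf01E.
have := normal_peak01_le R; rewrite [1 / 2]mul1r => h; apply: le_trans h.
rewrite ler_piMr ?invr_ge0// -expR0 ler_expR mulNr oppr_le0 divr_ge0//.
exact: sqr_ge0.
Qed.

Lemma exists_Phi_lt (R : realType) (e : R) : 0 < e -> exists x, Phi x%:E < e.
Proof.
(* [z >= 2] gives [z ^+ 2 / 2 >= z], and [z >= 1 / e] then makes the bound of [PhiN_le] smaller than
   [e]. *)
move=> e0; pose z := Num.max 2 (1 / e); exists (- z).
have z2 : 2 <= z by rewrite le_max lexx.
have ez : 1 <= e * z.
  by rewrite mulrC -ler_pdivrMr// le_max lexx orbT.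
apply: le_lt_trans (PhiN_le _) _; first by lra.
rewrite mulNr expRN.
have h : 1 / e <= expR (z ^+ 2 / 2).
  apply: le_trans (expR_ge1Dx _); rewrite ler_pdivrMr//; nra.
have : (expR (z ^+ 2 / 2))^-1 <= e.
  by rewrite -[e]invrK lef_pV2 ?posrE ?invr_gt0 ?expR_gt0// -div1r.
by have := e0; lra.
Qed.

Lemma Phi_surj (R : realType) (c : R) : 0 < c < 1 -> exists x, Phi x%:E = c.
Proof.
move=> /andP[c0 c1].
have [a ac] := exists_Phi_lt c0.
have [b0 bc] : exists x : R, Phi x%:E < 1 - c by apply: exists_Phi_lt; lra.
pose b := - b0.
have cb : c < Phi b%:E by rewrite PhiN; lra.
have ab : a <= b.
  by rewrite leNgt; apply/negP => /Phi_lt; lra.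
have [||x _ xc] := @IVT R (fun x : R => Phi x%:E) a b c ab.
- exact: continuous_subspaceT (@continuous_Phi R).
- by rewrite ge_min le_max (ltW ac) (ltW cb) orbT.
by exists x.
Qed.

(** The image of a standard Gaussian under its own distribution function is uniform; [c = 0] and
    [c = 1] are separate cases because [Phi] takes neither value at a real point. *)
Lemma normal_prob_Phi_le (R : realType) (c : R) : 0 <= c <= 1 ->
  normal_prob 0 1 [set g : R | Phi g%:E <= c] = c%:E.
Proof.
move=> /andP[]; rewrite le_eqVlt => /predU1P[<- _|c0].
  rewrite (_ : [set g | _] = set0) ?measure0//.
  by rewrite -subset0 => g /=; rewrite leNgt Phi_gt0.
rewrite le_eqVlt => /predU1P[->|c1].
  rewrite (_ : [set g | _] = setT) ?probability_setT//.
  by apply/seteqP; split => g //= _; exact: Phi_le1.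
have [x xc] : exists x, Phi x%:E = c by apply: Phi_surj; rewrite c0.
rewrite (_ : [set g | _] = `]-oo, x]%classic) -?PhiE ?xc//.
apply/seteqP; split => g /=; rewrite in_itv/= -xc; last exact: Phi_mono.
by move=> h; rewrite leNgt; apply/negP => /Phi_lt; rewrite ltNge h.
Qed.

Lemma PhiInv_lt1 (R : realType) (c : R) : 0 < c < 1 ->
  exists2 q : R, PhiInv c = q%:E & Phi q%:E = c.
Proof.
move=> c01; have [q qc] := Phi_surj c01; exists q => //.
apply/eqP; rewrite eq_le; apply/andP; split.
  by apply: ereal_inf_lbound; exists q; rewrite //= qc.
apply: le_ereal_inf_tmp => _ [x /= cx <-]; rewrite lee_fin leNgt.
by apply/negP => /Phi_lt; rewrite qc ltNge cx.
Qed.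

Lemma PhiInv1 (R : realType) : PhiInv (1 : R) = +oo%E.
Proof.
rewrite /PhiInv (_ : [set x | _] = set0) ?image_set0 ?ereal_inf0//.
by rewrite -subset0 => x /=; rewrite leNgt Phi_lt1.
Qed.

(** * Gaussian mixtures *)

(* The joint density of (V, a U + b V) factors through its second marginal,
   which is centered normal of variance a^2 + b^2. *)
Lemma normal_pdf_mix (R : realType) (a b v y : R) : 0 < a ->
  let t := Num.sqrt (a ^+ 2 + b ^+ 2) in
  normal_pdf (b * v) a y * normal_pdf 0 1 v =
  normal_pdf 0 t y * normal_pdf (b * y / t ^+ 2) (a / t) v.
Proof.
move=> a0 t; have t20 : 0 < a ^+ 2 + b ^+ 2.
  by rewrite ltr_pwDl ?exprn_gt0// sqr_ge0.
have t0 : 0 < t by rewrite sqrtr_gt0.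
have tE : t ^+ 2 = a ^+ 2 + b ^+ 2 by rewrite sqr_sqrtr// ltW.
rewrite (normal_pdf_std _ _ a0) (normal_pdf_std _ _ t0).
rewrite (normal_pdf_std _ _ (divr_gt0 a0 t0)) !normal_pdf01E subr0.
set p := (Num.sqrt _)^-1.
rewrite [LHS](_ : _ = p * p / a *
    (expR (- ((y - b * v) / a) ^+ 2 / 2) * expR (- v ^+ 2 / 2))); last ring.
rewrite [RHS](_ : _ = p * p / a * (expR (- (y / t) ^+ 2 / 2) *
    expR (- ((v - b * y / t ^+ 2) / (a / t)) ^+ 2 / 2))); last first.
  by field; rewrite !gt_eqF.
rewrite -!expRD; congr (_ * expR _).
have -> : (y / t) ^+ 2 = y ^+ 2 / t ^+ 2 by rewrite expr_div_n.
have -> : ((v - b * y / t ^+ 2) / (a / t)) ^+ 2 =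
    (v - b * y / t ^+ 2) ^+ 2 * t ^+ 2 / a ^+ 2.
  by field; rewrite !gt_eqF.
rewrite tE; field; rewrite !gt_eqF//.
Qed.

Lemma measurable_fun_Phi_affine (R : realType) (a b c : R) :
  measurable_fun setT (fun v : R => Phi ((c - b * v) / a)%:E).
Proof.
apply: continuous_measurable_fun => v.
apply: (@continuous_comp _ _ _ (fun v : R => (c - b * v) / a)
  (fun x : R => Phi x%:E)); last exact: continuous_Phi.
apply: cvgMr_tmp; apply: cvgB; first exact: cvg_cst.
by apply: cvgMl_tmp; exact: cvg_id.
Qed.

(** For independent standard [U] and [V], the integrand is the probability of [a U + b v <= c], and
    [a U + b V] is centred normal of variance [a^2 + b^2]. Tonelli's theorem and [normal_pdf_mix]
    make this precise. *)
Lemma integral_Phi_affine (R : realType) (a b c : R) : 0 < a ->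
  (\int[normal_prob 0 1]_v (Phi ((c - b * v) / a)%:E)%:E =
   (Phi (c / Num.sqrt (a ^+ 2 + b ^+ 2))%:E)%:E)%E.
Proof.
move=> a0; set t := Num.sqrt _.
have t20 : 0 < a ^+ 2 + b ^+ 2 by rewrite ltr_pwDl ?exprn_gt0// sqr_ge0.
have t0 : 0 < t by rewrite sqrtr_gt0.
rewrite integral_normal_prob; last 2 first.
- by apply/measurable_EFinP; exact: measurable_fun_Phi_affine.
- by move=> v; rewrite lee_fin Phi_ge0.
pose f (vy : measurableTypeR R * measurableTypeR R) : \bar R :=
  ((normal_pdf (b * vy.1) a vy.2 * normal_pdf 0 1 vy.1)%:E *
   (\1_(`]-oo, c]) vy.2)%:E)%E.
transitivity (\int[lebesgue_measure]_v \int[lebesgue_measure]_y f (v, y))%E.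
  apply: eq_integral => v _; rewrite -Phi_normal// /normal_prob /f/=.
  rewrite -ge0_integralZr//=; last 3 first.
  - apply/measurable_EFinP; apply/measurable_funTS; exact: measurable_normal_pdf.
  - by move=> y _; rewrite lee_fin normal_pdf_ge0.
  - by rewrite lee_fin normal_pdf_ge0.
  rewrite integral_mkcond; apply: eq_integral => y _.
  by rewrite patchE indicE; case: ifP; rewrite ?mule1 ?mule0.
rewrite fubini_tonelli; last 2 first.
- apply: emeasurable_funM.
    apply/measurable_EFinP; apply: measurable_funM.
      under eq_fun do rewrite normal_pdf_std//.
      apply: measurable_funM => //.
      apply: measurableT_comp; first exact: measurable_normal_pdf.
      apply: measurable_funM => //; apply: measurable_funB => //.
      exact: measurable_funM.
    apply: measurableT_comp; first exact: measurable_normal_pdf.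
    exact: measurable_fst.
  apply/measurable_EFinP; apply: measurableT_comp; last exact: measurable_snd.
  exact: measurable_indic.
- by move=> z; rewrite /f mule_ge0// lee_fin// mulr_ge0// normal_pdf_ge0.
transitivity (normal_prob 0 t `]-oo, c]); last by rewrite Phi_normal// subr0.
rewrite /normal_prob [RHS]integral_mkcond; apply: eq_integral => y _.
rewrite patchE /f/=; under eq_integral do rewrite normal_pdf_mix// -/t.
case: ifPn => yc; last first.
  by rewrite integral0_eq// => v _; rewrite indicE (negbTE yc) mule0.
under eq_integral do rewrite indicE yc mule1 EFinM.
rewrite ge0_integralZl//=.
- by rewrite integral_normal_pdf mule1.
- apply/measurable_EFinP; apply/measurable_funTS; exact: measurable_normal_pdf.
- by move=> v _; rewrite lee_fin normal_pdf_ge0.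
- by rewrite lee_fin normal_pdf_ge0.
Qed.

(** * Craig's lower bound for the Gaussian tail *)

(** The integrand is the derivative of [2 * Phi (s * u)], which starts at 1 and stays at most 2.
    This bounds the weight of the slopes in [[0, C]] at a fixed abscissa [s]. *)
Lemma integral_scaled_pdf_le (R : realType) (s C : R) : 0 <= s -> 0 < C ->
  (\int[lebesgue_measure]_(u in `[0%R, C])
     (2 * s * normal_pdf 0 1 (s * u))%:E <= 1)%E.
Proof.
move=> s0 C0.
have dF (u : R) : is_derive u 1 (fun u : R => 2 * Phi (s * u)%:E)
    (2 * s * normal_pdf 0 1 (s * u)).
  have h1 : is_derive u 1 (fun u : R => s * u) s.
    by apply: is_derive_eq; rewrite scaler1.
  have h2 := is_derive1_comp (f := fun x : R => Phi x%:E)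
    (is_derive_Phi (s * u)) h1.
  rewrite [X in is_derive _ _ _ X](_ : _ = 2 *: (normal_pdf 0 1 (s * u) * s)).
    exact: (is_deriveZ 2 h2).
  by rewrite /GRing.scale/=; ring.
rewrite (@continuous_FTC2 _ _ (fun u : R => 2 * Phi (s * u)%:E))//.
- rewrite mulr0 Phi0 -EFinB lee_fin; have := Phi_le1 (s * C); lra.
- apply: continuous_subspaceT => u; apply: cvgMl_tmp.
  apply: (@continuous_comp _ _ _ (fun u : R => s * u) (normal_pdf 0 1)).
    by apply: cvgMl_tmp; exact: cvg_id.
  by apply: continuous_normal_pdf; rewrite oner_eq0.
- have cF : continuous (fun u : R => 2 * Phi (s * u)%:E).
    move=> u; apply: differentiable_continuous; apply/derivable1_diffP.
    by have [] := dF u.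
  split.
  + by move=> u _; have [] := dF u.
  + by apply: cvg_at_right_filter; exact: cF.
  + by apply: cvg_at_left_filter; exact: cF.
- by move=> u _; rewrite derive1E; have [_ ->] := dF u.
Qed.

(** Density of two independent Gaussians at the point [(s, s * u)]: [s] is the Jacobian of the slope
    coordinate [u], and the factor 2 counts both signs of the slope. *)
Lemma normal_pdf01_polar (R : realType) (s u : R) :
  2 * s * normal_pdf 0 1 (s * u) * normal_pdf 0 1 s =
  s / pi * expR (- (s ^+ 2 * ((1 + u ^+ 2) / 2))).
Proof.
have p0 : 0 < pi *+ 2 :> R by have := pi_gt0 R; lra.
rewrite !normal_pdf01E.
have e : (Num.sqrt (pi *+ 2))^-1 * (Num.sqrt (pi *+ 2))^-1 = (pi *+ 2)^-1 :> R.
  by rewrite -invfM -expr2 sqr_sqrtr// ltW.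
set p := (Num.sqrt _)^-1 in e *.
rewrite [LHS](_ : _ = 2 * s * (p * p) *
  (expR (- (s * u) ^+ 2 / 2) * expR (- s ^+ 2 / 2))); last ring.
rewrite e -expRD; congr (_ * expR _); last by field.
by move: (pi_gt0 R); move: (pi : R) => q q0; field; rewrite gt_eqF.
Qed.

(** For a fixed slope the integral over the abscissa has an explicit antiderivative. The
    substitution [u = tan theta] turns the right-hand side into the integrand of Craig's formula. *)
Lemma integral_polar (R : realType) (x u : R) : 0 <= x ->
  (\int[lebesgue_measure]_(s in `[x, +oo[)
     (2 * s * normal_pdf 0 1 (s * u) * normal_pdf 0 1 s)%:E =
   ((expR (- (x ^+ 2 * ((1 + u ^+ 2) / 2)))) / (pi * (1 + u ^+ 2)))%:E)%E.
Proof.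
move=> x0; set k := (1 + u ^+ 2) / 2.
have k0 : 0 < k by rewrite divr_gt0// ltr_pwDl// sqr_ge0.
have pi0 := pi_gt0 R.
pose F (s : R) := - (expR (- (s ^+ 2 * k)) / (2 * pi * k)).
pose E (s : R) := expR (- (s ^+ 2 * k)).
have dE (s : R) : is_derive s 1 E (E s * - (2 * s * k)).
  have h1 : is_derive s 1 (fun s : R => - (s ^+ 2 * k)) (- (2 * s * k)).
    by apply: is_derive_eq; rewrite /GRing.scale/=; ring.
  exact: (is_derive1_comp (f := expR) (g := fun s : R => - (s ^+ 2 * k))
    (is_derive_expR (- (s ^+ 2 * k))) h1).
have cE : continuous E.
  move=> s; apply: differentiable_continuous; apply/derivable1_diffP.
  by have [] := dE s.
have dF (s : R) : is_derive s 1 F (s / pi * E s).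
  rewrite (_ : F = - (2 * pi * k)^-1 \*: E); last first.
    by apply/funext => r; rewrite /F/= /GRing.scale/=; rewrite mulrC mulNr.
  rewrite [X in is_derive _ _ _ X](_ : _ =
    - (2 * pi * k)^-1 *: (E s * - (2 * s * k))).
    exact: (is_deriveZ (- (2 * pi * k)^-1) (dE s)).
  rewrite /GRing.scale/=; move: pi0; move: (pi : R) => q q0.
  by field; rewrite !gt_eqF.
under eq_integral do rewrite normal_pdf01_polar -/k.
rewrite (@ge0_continuous_FTC2y _ _ F x 0)//.
- rewrite -EFinB sub0r opprK; congr (_ / _)%:E; rewrite /k.
  by move: (pi : R) => q; field.
- by move=> s xs; rewrite mulr_ge0 ?expR_ge0// divr_ge0 ?pi_ge0//; lra.
- apply: continuous_subspaceT => s; apply: cvgM; last exact: cE.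
  by apply: cvgMr_tmp; exact: cvg_id.
- rewrite -oppr0 -(mul0r (2 * pi * k)^-1); apply: cvgN; apply: cvgMr_tmp.
  apply: (cvg_comp (fun s : R => s ^+ 2 * k) (fun y => expR (- y)));
    last exact: cvgr_expR.
  by apply/gt0_cvgMly => //; exact: cvgr_expr2.
- apply: cvg_at_right_filter.
  apply: differentiable_continuous; apply/derivable1_diffP.
  by have [] := dF x.
- by move=> s _; rewrite derive1E; have [_ ->] := dF s.
Qed.

(** The tangent to [expR (- y)] at [c]; integrating it proves Jensen's inequality below. *)
Lemma expR_tangent (R : realType) (c y : R) :
  expR (- c) * (1 + c - y) <= expR (- y).
Proof.
have -> : expR (- y) = expR (- c) * expR (c - y).
  by rewrite -expRD; congr expR; ring.
rewrite ler_wpM2l ?expR_ge0//; have := expR_ge1Dx (c - y); lra.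
Qed.

(* Craig's formula writes the tail of Phi as an average of Gaussians; keep only
   the angles with tangent at most C and bound the average below by Jensen. *)
Lemma Phi_craig_ge (R : realType) (C x : R) : 0 < C -> 0 <= x ->
  atan C / pi * expR (- (C / (2 * atan C) * x ^+ 2)) <= Phi (- x)%:E.
Proof.
(* [c] is the mean of [x ^+ 2 * ((1 + u ^+ 2) / 2)] for the weight [1 / (1 + u ^+ 2)] on [[0, C]],
   hence the point of tangency that Jensen's inequality requires. *)
move=> C0 x0; set c := C / _ * _.
have pi0 := pi_gt0 R.
have aC0 : 0 < atan C by rewrite -(@atan0 R); exact: lt_atan.
pose g (s u : R) := 2 * s * normal_pdf 0 1 (s * u) * normal_pdf 0 1 s.
pose f (z : measurableTypeR R * measurableTypeR R) : \bar R :=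
  ((g z.1 z.2)%:E * ((\1_(`[x, +oo[) z.1)%:E * (\1_(`[0, C]) z.2)%:E))%E.
pose lo (u : R) := expR (- c) / pi * ((1 + c) / (1 + u ^+ 2) - x ^+ 2 / 2).
have lo_le u : lo u <= expR (- (x ^+ 2 * ((1 + u ^+ 2) / 2))) / (pi * (1 + u ^+ 2)).
  have u0 : 0 < 1 + u ^+ 2 by rewrite ltr_pwDl// sqr_ge0.
  rewrite ler_pdivlMr ?mulr_gt0//.
  apply: le_trans (expR_tangent c _).
  rewrite /lo le_eqVlt; apply/orP; left; apply/eqP.
  by move: pi0; move: (pi : R) => q q0; field; rewrite !gt_eqF.
pose L (u : R) := expR (- c) / pi * ((1 + c) * atan u - x ^+ 2 / 2 * u).
have dL (u : R) : is_derive u 1 L (lo u).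
  apply: is_derive_eq; rewrite /lo /GRing.scale/=.
  by move: (expR _ / _) (1 + c) ((1 + u ^+ 2)^-1) => p q r; ring.
have cL : continuous L.
  move=> u; apply: differentiable_continuous; apply/derivable1_diffP.
  by have [] := dL u.
have clo : continuous lo.
  move=> u; apply: cvgMl_tmp; apply: cvgB; last exact: cvg_cst.
  by apply: cvgMl_tmp; exact: continuous_oneDsqrV.
(* By the choice of [c], the terms [c * atan C] and [x ^+ 2 / 2 * C] cancel. *)
have I_lo : (\int[lebesgue_measure]_(u in `[0%R, C]) (lo u)%:E =
    (atan C / pi * expR (- c))%:E)%E.
  rewrite (@continuous_FTC2 _ _ L)//.
  - rewrite -EFinB; congr _%:E; rewrite /L atan0 /c.
    by move: pi0; move: (pi : R) => q q0; field; rewrite !gt_eqF.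
  - exact: continuous_subspaceT.
  - split.
    + by move=> u _; have [] := dL u.
    + by apply: cvg_at_right_filter; exact: cL.
    + by apply: cvg_at_left_filter; exact: cL.
  - by move=> u _; rewrite derive1E; have [_ ->] := dL u.
have f0 z : (0 <= f z)%E.
  rewrite /f !indicE; have [|] := boolP (z.1 \in _); last by rewrite mul0e mule0.
  rewrite inE/= in_itv/= andbT => xz; rewrite !mule_ge0// lee_fin /g.
  by rewrite !mulr_ge0 ?normal_pdf_ge0//; lra.
have mf : measurable_fun setT f.
  apply: emeasurable_funM; last apply: emeasurable_funM.
  - apply/measurable_EFinP; apply: measurable_funM.
      apply: measurable_funM.
        by apply: measurable_funM => //; exact: measurable_fst.
      apply: measurableT_comp; first exact: measurable_normal_pdf.
      by apply: measurable_funM; [exact: measurable_fst|exact: measurable_snd].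
    apply: measurableT_comp; first exact: measurable_normal_pdf.
    exact: measurable_fst.
  - apply/measurable_EFinP; apply: measurableT_comp; last exact: measurable_fst.
    exact: measurable_indic.
  - apply/measurable_EFinP; apply: measurableT_comp; last exact: measurable_snd.
    exact: measurable_indic.
have mpdf D (mD : measurable D) :
    measurable_fun D (fun s : measurableTypeR R => (normal_pdf 0 1 s)%:E).
  by apply/measurable_EFinP; apply/measurable_funTS; exact: measurable_normal_pdf.
(* Integrating over the slope first leaves at most the Gaussian density on [[x, +oo[], hence the
   tail. *)
have le1 : (\int[lebesgue_measure]_s \int[lebesgue_measure]_u f (s, u) <=
    (Phi (- x)%:E)%:E)%E.
  rewrite PhiN -Phi_compl_closed /normal_prob [leRHS]integral_mkcond.
  apply: ge0_le_integral => //.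
  - by move=> s _; apply: integral_ge0.
  - by apply: measurable_fun_fubini_tonelli_F.
  - by apply/(measurable_restrictT _ _).1 => //; exact: mpdf.
  move=> s _; rewrite patchE /f/=; case: ifPn => sx; last first.
    by rewrite integral0_eq// => u _; rewrite indicE (negbTE sx) mul0e mule0.
  have s0 : 0 <= s.
    by move: sx; rewrite inE/= in_itv/= andbT; apply: le_trans.
  rewrite -[leRHS]mul1e.
  apply: le_trans (lee_wpmul2r _ (integral_scaled_pdf_le s0 C0)); last first.
    by rewrite lee_fin normal_pdf_ge0.
  rewrite -ge0_integralZr//=; last 3 first.
  - apply/measurable_EFinP; apply/measurable_funTS; apply: measurable_funM => //.
    apply: measurableT_comp; first exact: measurable_normal_pdf.
    exact: measurable_funM.
  - by move=> u _; rewrite lee_fin !mulr_ge0 ?normal_pdf_ge0.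
  - by rewrite lee_fin normal_pdf_ge0.
  rewrite [leRHS]integral_mkcond le_eqVlt; apply/orP; left; apply/eqP.
  apply: eq_integral => u _; rewrite patchE !indicE sx mul1e.
  by case: ifP; rewrite ?mule1 ?mule0.
rewrite -lee_fin -I_lo; apply: le_trans le1.
(* In the other order, [integral_polar] produces the integrand that [lo] minorizes. *)
rewrite fubini_tonelli//.
pose h (u : R) := expR (- (x ^+ 2 * ((1 + u ^+ 2) / 2))) / (pi * (1 + u ^+ 2)).
rewrite [leRHS](_ : _ =
    \int[lebesgue_measure]_(u in `[0%R, C]) (h u)%:E)%E; last first.
  rewrite [RHS]integral_mkcond; apply: eq_integral => u _; rewrite patchE /f/=.
  case: ifPn => uC; last first.
    rewrite integral0_eq// => s _.
    by rewrite [X in (_ * (_ * X%:E))%E]indicE (negbTE uC) !mule0.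
  rewrite -integral_polar// [RHS]integral_mkcond; apply: eq_integral => s _.
  by rewrite patchE !indicE uC mule1; case: ifP; rewrite ?mule1 ?mule0.
have cint (k : R -> R) : continuous k ->
    lebesgue_measure.-integrable `[0%R, C] (EFin \o k).
  move=> ck; apply: continuous_compact_integrable; first exact: segment_compact.
  exact: continuous_subspaceT.
apply: le_integral => //.
- exact: cint.
- apply: cint => u; apply: cvgM.
    apply: continuous_comp; last exact: continuous_expR.
    apply: cvgN; apply: cvgMl_tmp; apply: cvgMr_tmp.
    exact: continuous_oneDsqr.
  move: u; rewrite -/(continuous (fun u : R => (pi * (1 + u ^+ 2))^-1)).
  under eq_fun do rewrite invfM.
  by move=> u; apply: cvgMl_tmp; exact: continuous_oneDsqrV.
by move=> u _; rewrite lee_fin; exact: lo_le.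
Qed.

Lemma c12_gt0 (R : realType) (w : R) : 0 < w -> w < pi / 2 ->
  0 < c1 w /\ 0 < c2 w.
Proof.
move=> w0 wpi; have pi0 := pi_gt0 R; split.
  rewrite /c1 subr_gt0 ltr_pdivrMr//; lra.
have s0 : 0 < sin w by apply: sin_gt0_pi; rewrite w0/=; lra.
have k0 : 0 < cos w by apply: cos_gt0_pihalf; lra.
by rewrite /c2 !divr_gt0//; lra.
Qed.

Lemma atan_cot (R : realType) (w : R) : 0 < w -> w < pi / 2 ->
  atan (cos w / sin w) = pi / 2 - w.
Proof.
move=> w0 wpi; rewrite -[RHS]tanK ?in_itv/=; last first.
  by apply/andP; split; have := pi_gt0 R; lra.
by rewrite /tan -opprB sinN sinBpihalf opprK cosN cosBpihalf.
Qed.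

(** Craig's bound at [C = cos w / sin w], for which [atan C = pi / 2 - w]; this is where [c1] and
    [c2] come from. *)
Lemma Phi_c1_c2_ge (R : realType) (w x : R) :
  0 < w -> w < pi / 2 -> 0 <= x ->
  c1 w * expR (- (c2 w * x ^+ 2)) <= Phi (- x)%:E.
Proof.
move=> w0 wpi x0; have pi0 := pi_gt0 R.
have s0 : 0 < sin w by apply: sin_gt0_pi; rewrite w0/=; lra.
have k0 : 0 < cos w by apply: cos_gt0_pihalf; lra.
have := Phi_craig_ge (divr_gt0 k0 s0) x0; rewrite atan_cot//.
have -> : (pi / 2 - w) / pi = c1 w.
  by rewrite /c1; move: pi0; move: (pi : R) => q q0; field; rewrite gt_eqF.
suff -> : cos w / sin w / (2 * (pi / 2 - w)) = c2 w by [].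
by rewrite /c2; congr (_ / _); field.
Qed.

(** Compares [sin (pi / 6) = 1 / 2] with [pi / 6], the sine having slope at most 1. *)
Lemma pi_ge3 (R : realType) : 3 <= pi :> R.
Proof.
have pi0 := pi_gt0 R.
have s : sin (pi / 6) = 1 / 2 :> R.
  have k0 : 0 < cos (pi / 6) :> R by apply: cos_gt0_pihalf; lra.
  (* The double-angle formula on the left leaves [2 * sin (pi / 6) = 1] after division by the
     positive cosine. *)
  have : sin (pi / 6 *+ 2) = cos (pi / 6) :> R.
    by rewrite -cosBpihalf -cosN; congr cos; field.
  rewrite sin_mulr2n => h.
  have : cos (pi / 6) * (sin (pi / 6) * 2 - 1) = 0 :> R by lra.
  by move/eqP; rewrite mulf_eq0 gt_eqF//= => /eqP; lra.
have [y _ e] := @MVT _ (@sin R) (@cos R) 0 (pi / 6) ltac:(lra)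
  (fun y _ => is_derive_sin y) (continuous_subspaceT (@continuous_sin R)).
have : cos y * (pi / 6 - 0) <= 1 * (pi / 6).
  by rewrite subr0 ler_wpM2r ?cos_le1//; lra.
by rewrite -e s sin0; lra.
Qed.

(** Craig's bound at [C = 1], with its rate [2 / pi] enlarged to [2 / 3]. *)
Lemma Phi_quarter_ge (R : realType) (x : R) : 0 <= x ->
  expR (- (2 / 3 * x ^+ 2)) / 4 <= Phi (- x)%:E.
Proof.
move=> x0; apply: le_trans (Phi_craig_ge ltr01 x0); rewrite atan1.
have p3 := pi_ge3 R.
have -> : pi / 4 / pi = 1 / 4 :> R by field; lra.
rewrite mulrC div1r ler_wpM2l// ler_expR lerN2 ler_wpM2r ?sqr_ge0//.
rewrite ler_pdivrMr; lra.
Qed.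

(** * Stochastic domination of the minimum *)

(** The numerator of [sigma2_], positive because [ln 2 < 1]; about 0.3665. *)
Definition kappa (R : realType) : R := - ln (ln 2).

Lemma ln2_gt0 (R : realType) : 0 < ln 2 :> R.
Proof. by rewrite ln_gt0// ltr1n. Qed.

Lemma expR_kappa (R : realType) : expR (kappa R) = (ln 2)^-1.
Proof. by rewrite /kappa expRN lnK// posrE ln2_gt0. Qed.

(** * Numerical bounds for the exponential, [ln 2] and [kappa] *)

Lemma expR_ge_series (R : realType) (x : R) n : 0 <= x ->
  \sum_(0 <= i < n) x ^+ i / i`!%:R <= expR x.
Proof.
move=> x0; apply: nondecreasing_cvgn_le (is_cvg_series_exp_coeff x) n.
by apply: nondecreasing_series => i _ _; exact: exp_coeff_ge0.
Qed.

Lemma expR_ge_sum4 (R : realType) (x : R) : 0 <= x ->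
  1 + x + x ^+ 2 / 2 + x ^+ 3 / 6 + x ^+ 4 / 24 <= expR x.
Proof.
move=> /(expR_ge_series 5); apply: le_trans.
rewrite !big_nat_recr//= big_geq// !factS fact0 !muln1/=.
lra.
Qed.

Lemma ln2_le (R : realType) : ln 2 <= 25 / 36 :> R.
Proof.
rewrite -[leRHS]expRK ler_ln ?posrE ?expR_gt0//.
apply: le_trans (expR_ge_sum4 _); lra.
Qed.

Lemma kappa_ge (R : realType) : 9 / 25 <= kappa R.
Proof.
rewrite /kappa lerNr -[leRHS]expRK ler_ln ?posrE ?expR_gt0 ?ln2_gt0//.
apply: le_trans (ln2_le R) _.
have h : 49 / 50 <= expR (- (1 / 50)) :> R.
  by apply: le_trans (expR_ge1Dx _); lra.
have pow (k : nat) (p q y : R) : 0 <= q -> p <= q ^+ k -> q <= y -> p <= y ^+ k.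
  by move=> q0 pq qy; apply: le_trans pq _; rewrite lerXn2r ?nnegrE//; lra.
(* [expR (- (9 / 25))] is the 18th power of [expR (- (1 / 50))], taken in stages of exponents 3, 2
   and 3 with the intermediate values rounded down to [16 / 17] and [31 / 35]. *)
have : 25 / 36 <= expR (- (1 / 50)) ^+ 3 ^+ 2 ^+ 3 :> R.
  apply: (pow _ _ (31 / 35)); [lra|lra|].
  apply: (pow _ _ (16 / 17)); [lra|lra|].
  by apply: (pow _ _ (49 / 50)); [lra|lra|].
move/le_trans; apply; rewrite -!exprM -expRM_natl ler_expR !natrM; lra.
Qed.

(** Convexity: the tangent at [u] lies below the function at [0] and at [l] ([h1] and [h2]), and the
    weights [1 - u / l] and [u / l] combine the two. *)
Lemma expRN_chord (R : realType) (l u : R) : 0 < l -> 0 <= u <= l ->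
  expR (- u) <= 1 - u / l * (1 - expR (- l)).
Proof.
move=> l0 /andP[u0 ul]; set v := expR (- u).
have h1 : v * (1 + u) <= 1.
  have := expR_ge1Dx u; rewrite -(ler_pM2l (expR_gt0 (- u))) -expRD addNr expR0.
  by [].
have h2 : v * (1 + u - l) <= expR (- l).
  have := expR_ge1Dx (u - l); rewrite -(ler_pM2l (expR_gt0 (- u))) -expRD.
  by rewrite addrA (_ : - u + (u - l) = - l)//; ring.
have lam : 0 <= u / l <= 1.
  by apply/andP; split; [rewrite divr_ge0// ltW|rewrite ler_pdivrMr// mul1r].
have e : u = u / l * l by field; rewrite gt_eqF.
move: lam e; set k := u / l => /andP[k0 k1] e.
have k1' : 0 <= 1 - k by lra.
have := ler_wpM2l k1' h1; have := ler_wpM2l k0 h2.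
rewrite {1 2}e; nra.
Qed.

(* With u = exp (- (t + e)) the left-hand side is exp (- u).  For u >= ln 2 both sides
   are separated by 1/2; for u <= ln 2 the chord of exp (- u) over [0, ln 2] and
   exp kappa = 1 / ln 2 leave a perfect square in t. *)
Lemma gumbel_le_gauss_right (R : realType) (t e : R) : 0 <= t -> 0 <= e ->
  expR (- expR (- (t + e))) <=
  1 - expR (- (t ^+ 2 / (4 * kappa R) + e)) / 2.
Proof.
move=> t0 e0; set u := expR (- (t + e)); have k := kappa_ge R.
have k4 : 0 <= 4 * kappa R by lra.
have l2 := ln2_gt0 R.
have h2 : expR (- ln 2) = 1 / 2 :> R by rewrite expRN lnK ?posrE// div1r.
have [ul|lu] := leP u (ln 2); last first.
  have : expR (- u) <= expR (- ln 2) by rewrite ler_expR lerN2 ltW.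
  have : expR (- (t ^+ 2 / (4 * kappa R) + e)) <= 1.
    by rewrite -[leRHS]expR0 ler_expR oppr_le0 addr_ge0// divr_ge0 ?sqr_ge0.
  by rewrite h2; lra.
have u0 : 0 <= u <= ln 2 by rewrite ul expR_ge0.
apply: le_trans (expRN_chord l2 u0) _; rewrite h2.
suff : expR (- (t ^+ 2 / (4 * kappa R) + e)) <= u / ln 2 by lra.
rewrite -expR_kappa -expRD ler_expR -subr_ge0.
have -> : - (t + e) + kappa R - - (t ^+ 2 / (4 * kappa R) + e) =
    (t - 2 * kappa R) ^+ 2 / (4 * kappa R).
  by field; rewrite gt_eqF//; lra.
by rewrite divr_ge0 ?sqr_ge0//; lra.
Qed.

(* Near the centre the tail is compared with its tangent at 0, further out with
   the Gaussian minorant at angle pi/4. *)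
Lemma gumbel_le_gauss_small (R : realType) (t z : R) : 0 <= t <= 1 / 2 ->
  0 <= z <= 59 / 50 * t -> forall y, t - t / 200 <= y ->
  expR (- expR y) <= Phi (- z)%:E.
Proof.
move=> /andP[t0 t5] /andP[z0 zt] y ty; apply: le_trans (PhiN_ge z0).
(* [q] is the guaranteed lower bound for [y], and [1 + w] is the quadratic Taylor polynomial of
   [expR q]. *)
pose q := 199 / 200 * t.
have q0 : 0 <= q by rewrite /q; lra.
have qy : q <= y by rewrite /q; lra.
pose w := q + q ^+ 2 / 2.
have w0 : 0 <= w by rewrite addr_ge0// divr_ge0// sqr_ge0.
have e1 : 1 + w <= expR y.
  apply: le_trans (_ : expR q <= _); last by rewrite ler_expR.
  apply: le_trans (expR_ge_sum4 q0); rewrite /w.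
  by have := exprn_ge0 3 q0; have := exprn_ge0 4 q0; lra.
(* [65 / 24 = 1 + 1 + 1/2 + 1/6 + 1/24] is a lower bound for [expR 1]. *)
have e2 : 65 / 24 * (1 + w + w ^+ 2 / 2) <= expR (1 + w).
  rewrite expRD ler_pM//; first by rewrite addr_ge0 ?divr_ge0 ?sqr_ge0//; lra.
    by apply: le_trans (expR_ge_sum4 ler01); lra.
  apply: le_trans (expR_ge_sum4 w0).
  by have := exprn_ge0 3 w0; have := exprn_ge0 4 w0; lra.
have e3 : 1 <= (1 / 2 - 59 / 100 * t) * expR (1 + w).
  have tE : t = 200 / 199 * q by rewrite /q; lra.
  have q5 : q <= 1 / 2 by rewrite /q; lra.
  have qk k : q ^+ k <= (1 / 2) ^+ k by apply: lerXn2r; rewrite ?nnegrE//; lra.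
  have := qk 2; have := qk 3; have := qk 4; have := qk 5.
  have : 0 <= 1 / 2 - 59 / 100 * t by lra.
  move=> /ler_wpM2l /(_ _ _ e2) h h5 h4 h3 h2; apply: le_trans h.
  move: h5 h4 h3 h2 q5; rewrite tE /w; move: q q0 {qk tE qy w w0 e1 e2} => q q0.
  by move=> *; lra.
have e4 : expR (- expR y) <= expR (- (1 + w)) by rewrite ler_expR lerN2.
apply: le_trans e4 _; rewrite expRN.
apply: le_trans (_ : 1 / 2 - 59 / 100 * t <= _); last by lra.
by rewrite -[X in X <= _]div1r ler_pdivrMr ?expR_gt0.
Qed.

(** The constants come from the minorant [Phi_quarter_ge]: [25 / 18 >= 2 * ln 2] and
    [13 / 14 >= 2 / 3 * (25 / 18 + 1 / 400)]. The shift restores [t = q + 1 / 100]. *)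
Lemma expR_ge_quadratic_near (R : realType) (q : R) : 49 / 100 <= q ->
  25 / 18 + 13 / 14 * (q + 1 / 100) ^+ 2 <= expR q.
Proof.
move=> q4; have q0 : 0 <= q by lra.
apply: le_trans (expR_ge_sum4 q0).
have r0 : 0 <= q - 49 / 100 by lra.
have := mulr_ge0 r0 (sqr_ge0 (q - 49 / 100 - 1)).
by have := exprn_ge0 4 q0; have := sqr_ge0 (q - 49 / 100); lra.
Qed.

Lemma expR_ge_quadratic_far (R : realType) (r : R) : 10 <= r ->
  25 / 18 + 13 / 14 * (2 * r) ^+ 2 <= expR r.
Proof.
move=> r10; have r0 : 0 <= r by lra.
apply: le_trans (expR_ge_sum4 r0).
have h1 : 0 <= (r - 10) * (r + 10) by rewrite mulr_ge0; lra.
have := mulr_ge0 (sqr_ge0 r) h1; have := exprn_ge0 3 r0; have := sqr_ge0 r.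
by move=> *; lra.
Qed.

(** Up to [t = 1 / 2] the bound near the centre applies. Beyond it, [Phi_quarter_ge] reduces the
    claim to a quadratic lying below an exponential: up to 20 the correction [t ^+ 2 / (4 * L)] is
    at most [1 / 100] because [L >= 10000], and later it is at most [t / 2] because [t <= 2 * L]. *)
Lemma gumbel_le_gauss_left (R : realType) (L t z : R) :
  100 <= L / 100 -> 0 <= t <= 2 * L -> 0 <= z ->
  z ^+ 2 = t ^+ 2 / (2 * kappa R) + t ^+ 2 / (2 * L) ->
  expR (- expR (t - t ^+ 2 / (4 * L))) <= Phi (- z)%:E.
Proof.
move=> L100 /andP[t0 tL] z0 zE; have k := kappa_ge R.
have L0 : 0 < L by lra.
have t2 := sqr_ge0 t.
(* [25 / 18] bounds [1 / (2 * kappa R)] by [kappa_ge]; the sum [25 / 18 + 1 / 400] stays below the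
   square of [59 / 50]. *)
have zt : z ^+ 2 <= 25 / 18 * t ^+ 2 + t ^+ 2 / 400.
  rewrite zE lerD//.
    rewrite ler_pdivrMr; last lra.
    by have := ler_wpM2l t2 k; lra.
  by rewrite ler_wpM2l// lef_pV2 ?posrE; lra.
have [t5|t5] := leP t (1 / 2).
  have t05 : 0 <= t <= 1 / 2 by rewrite t0.
  apply: (gumbel_le_gauss_small t05).
    rewrite z0/= leNgt; apply/negP => zt'.
    have h1 : 0 < z - 59 / 50 * t by lra.
    have h2 : 0 < z + 59 / 50 * t by lra.
    by have := mulr_gt0 h1 h2; lra.
  rewrite lerD2l lerN2 ler_pdivrMr; last lra.
  by have := ler_wpM2l t0 t5; have := ler_wpM2l t0 L100; lra.
apply: le_trans (Phi_quarter_ge z0).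
suff h : 25 / 18 + 13 / 14 * t ^+ 2 <= expR (t - t ^+ 2 / (4 * L)).
  have -> : 4^-1 = expR (- (2 * ln 2)) :> R.
    by rewrite expRN expRM_natl lnK ?posrE// -natrX.
  by rewrite -expRD ler_expR; have := ln2_le R; lra.
have [t20|t20] := leP t 20.
  pose q := t - 1 / 100.
  have qy : q <= t - t ^+ 2 / (4 * L).
    rewrite lerD2l lerN2 ler_pdivrMr; last lra.
    have : t ^+ 2 <= 20 ^+ 2 by rewrite ler_sqr ?nnegrE.
    by lra.
  apply: le_trans (_ : expR q <= _); last by rewrite ler_expR.
  have q4 : 49 / 100 <= q by rewrite /q; lra.
  by apply: le_trans (expR_ge_quadratic_near q4); rewrite /q subrK.
pose r := t / 2.
have ry : r <= t - t ^+ 2 / (4 * L).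
  suff : t ^+ 2 / (4 * L) <= t / 2 by rewrite /r; lra.
  rewrite ler_pdivrMr; last lra.
  by have := ler_wpM2l t0 tL; lra.
apply: le_trans (_ : expR r <= _); last by rewrite ler_expR.
have r10 : 10 <= r by rewrite /r; lra.
apply: le_trans (expR_ge_quadratic_far r10).
by rewrite (_ : 2 * r = t)// /r; lra.
Qed.

Lemma Phi_expn_le_gumbel (R : realType) (w s : R) (n : nat) :
  0 < w -> w < pi / 2 -> 0 < n%:R * c1 w -> 0 <= s ->
  Phi s%:E ^+ n <= expR (- expR (ln (n%:R * c1 w) - c2 w * s ^+ 2)).
Proof.
move=> w0 wpi nc0 s0; rewrite expRD lnK ?posrE//.
have h : Phi s%:E <= expR (- (c1 w * expR (- (c2 w * s ^+ 2)))).
  have := Phi_c1_c2_ge w0 wpi s0; rewrite PhiN => h.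
  by apply: le_trans (expR_ge1Dx _); lra.
apply: le_trans (lerXn2r n _ _ h) _; rewrite ?nnegrE ?Phi_ge0 ?expR_ge0//.
by rewrite -expRM_natl ler_expR; lra.
Qed.

(** Serves the negative argument [- s], which the Gumbel form does not reach. Since
    [g^-1 <= 8 * c * L], [a ^+ 2 * c = L] and [c <= L], the exponent on the right is at most of
    order [(1 + s ^+ 2) * L ^+ 2], whereas [n >= expR L >= 45 * L ^+ 2]. *)
Lemma expRN_ge_craig (R : realType) (n : nat) (c L a s g : R) :
  0 < c -> c <= L -> 100 <= L -> expR L <= n%:R -> 0 <= a -> 0 <= s ->
  a ^+ 2 * c = L -> 0 < g -> g * (2 * c * (L + kappa R)) = kappa R ->
  (expR (- s ^+ 2 / 2) / 2) ^+ n <= expR (- (2 / 3 * ((a + s) ^+ 2 / g))) / 4.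
Proof.
move=> c0 cL L100 Ln a0 s0 aL g0 gE; have k := kappa_ge R.
have L0 : 0 <= L by lra.
pose D := g^-1.
have DE : D * kappa R = 2 * c * (L + kappa R) by rewrite -{1}gE /D mulKf// gt_eqF.
have D0 : 0 < D by rewrite invr_gt0.
have D8 : D <= 8 * c * L.
  have h1 : 0 <= c * (L - 1) by rewrite mulr_ge0; lra.
  have h2 : 0 <= c * L * (kappa R - 9 / 25) by rewrite !mulr_ge0; lra.
  have h3 : 0 <= c * (L - 1) * kappa R by rewrite !mulr_ge0; lra.
  rewrite -(ler_pM2r (_ : 0 < kappa R)) ?DE; lra.
have nL : 45 * L ^+ 2 <= n%:R.
  apply: le_trans Ln; apply: le_trans (expR_ge_sum4 L0).
  have h1 : 0 <= (L - 100) * (L + 100) by rewrite mulr_ge0; lra.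
  have := mulr_ge0 (sqr_ge0 L) h1; have := exprn_ge0 3 L0; have := sqr_ge0 L.
  by move=> *; lra.
have n1 : 4 / 3 * D <= n%:R / 2.
  have h : 0 <= (L - c) * L by rewrite mulr_ge0; lra.
  by have := sqr_ge0 L; lra.
(* The summand 2 absorbs [2 * ln 2], which comes from the factor 1/4. *)
have n2 : 4 / 3 * (a ^+ 2 * D) + 2 <= n%:R / 2.
  have := ler_wpM2l (sqr_ge0 a) D8; rewrite -aL.
  have -> : a ^+ 2 * (8 * c * (a ^+ 2 * c)) = 8 * (a ^+ 2 * c) ^+ 2 by ring.
  rewrite aL => h.
  have h2 : 0 <= (L - 100) * (L + 100) by rewrite mulr_ge0; lra.
  by lra.
have l2 : expR (- ln 2) = 2^-1 :> R by rewrite expRN lnK ?posrE.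
have l4 : expR (- (2 * ln 2)) = 4^-1 :> R.
  by rewrite expRN expRM_natl lnK ?posrE// -natrX.
rewrite -[X in (_ * X) ^+ n]l2 -[X in _ <= _ * X]l4 -!expRD -expRM_natl.
rewrite ler_expR -/D.
have l20 : 1 / 2 <= ln 2 :> R.
  suff : - ln 2 <= - (1 / 2) :> R by lra.
  by rewrite -ler_expR l2; apply: le_trans (expR_ge1Dx _); lra.
have l21 := ln2_le R.
have h1 : (a + s) ^+ 2 * D <= 2 * (a ^+ 2 * D) + 2 * (s ^+ 2 * D).
  by have := mulr_ge0 (sqr_ge0 (a - s)) (ltW D0); lra.
have h2 := ler_wpM2l (sqr_ge0 s) n1.
have n0 : 0 <= n%:R :> R by [].
have h3 := ler_wpM2l n0 l20.
by move: (n%:R : R) (ln 2 : R) n0 l20 l21 h1 h2 h3 n2 n1 => N l *; lra.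
Qed.

(** Three ranges of [s] are treated in turn: right of [a], between 0 and [a], and negative. *)
Lemma Phi_expn_le (R : realType) (w : R) (n : nat) (s : R) :
  0 < w -> w < pi / 2 -> 0 < n%:R * c1 w ->
  100 <= ln (n%:R * c1 w) / 100 -> c2 w <= ln (n%:R * c1 w) ->
  Phi s%:E ^+ n <= Phi ((s + mu_ w n) / Num.sqrt (sigma2_ w n))%:E.
Proof.
move=> w0 wpi nc0; have [c10 c20] := c12_gt0 w0 wpi.
have h1 := @Phi_expn_le_gumbel _ w s n w0 wpi nc0.
have lnE := lnK nc0; rewrite /mu_ /sigma2_.
move: h1 lnE c20; set L := ln _; set c := c2 w => h1 lnE c20 L4 cL.
have L100 : 100 <= L by lra.
have k := kappa_ge R.
rewrite (_ : - ln (ln 2) = kappa R)//.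
set a := Num.sqrt (L / c); set g := kappa R / _.
have L0 : 0 < L by lra.
have kp : 0 < kappa R by lra.
have den0 : 0 < 2 * c * (L + kappa R).
  by rewrite mulr_gt0 ?addr_gt0// mulr_gt0.
have g0 : 0 < g by rewrite divr_gt0.
have gE : g * (2 * c * (L + kappa R)) = kappa R by rewrite divfK// gt_eqF.
have a0 : 0 <= a by rewrite sqrtr_ge0.
have aL : a ^+ 2 * c = L by rewrite sqr_sqrtr ?divfK ?gt_eqF// divr_ge0// ltW.
have sg0 : 0 < Num.sqrt g by rewrite sqrtr_gt0.
have sgE : Num.sqrt g ^+ 2 = g by rewrite sqr_sqrtr// ltW.
have ca : 0 <= 2 * c * a by rewrite mulr_ge0// ltW// mulr_gt0.
pose t := 2 * c * a * (s - a).
have zE : ((s - a) / Num.sqrt g) ^+ 2 = t ^+ 2 / (2 * kappa R) + t ^+ 2 / (2 * L).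
  rewrite exprMn exprVn sgE.
  have -> : t ^+ 2 = 4 * c * L * (s - a) ^+ 2 by rewrite /t -aL; ring.
  by rewrite /g; field; rewrite !gt_eqF//; lra.
have tE : L - c * s ^+ 2 = - t - t ^+ 2 / (4 * L).
  have -> : t ^+ 2 / (4 * L) = c * (s - a) ^+ 2.
    have -> : t ^+ 2 = 4 * c * L * (s - a) ^+ 2 by rewrite /t -aL; ring.
    by field; rewrite gt_eqF.
  by rewrite /t -aL; ring.
have [sa|sa] := leP a s.
  have t0 : 0 <= t by rewrite /t mulr_ge0// subr_ge0.
  apply: le_trans (h1 _) _; first by lra.
  rewrite tE -opprD; apply: le_trans (gumbel_le_gauss_right t0 _) _.
    by rewrite divr_ge0 ?sqr_ge0//; lra.
  set z := _ / _ in zE *.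
  have z0 : 0 <= z by rewrite /z divr_ge0 ?sqrtr_ge0//; lra.
  have := PhiN_le z0; rewrite PhiN mulNr zE.
  have -> : (t ^+ 2 / (2 * kappa R) + t ^+ 2 / (2 * L)) / 2 =
    t ^+ 2 / (4 * kappa R) + t ^+ 2 / (4 * L).
    by field; rewrite !gt_eqF//; lra.
  by lra.
pose z := (a - s) / Num.sqrt g.
have -> : (s - a) / Num.sqrt g = - z by rewrite /z -mulNr opprB.
have z0 : 0 <= z by rewrite /z divr_ge0 ?sqrtr_ge0//; lra.
have zE' : z ^+ 2 = (- t) ^+ 2 / (2 * kappa R) + (- t) ^+ 2 / (2 * L).
  by rewrite sqrrN -zE /z -sqrrN -mulNr opprB.
have [s0|s0] := leP 0 s.
  apply: le_trans (h1 s0) _; rewrite tE -[t ^+ 2]sqrrN.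
  apply: gumbel_le_gauss_left => //.
  (* The comparison on the left is applied to [- t], and [- t <= 2 * L] amounts to [s >= 0]. *)
  rewrite /t oppr_ge0; apply/andP; split.
    by rewrite mulr_ge0_le0// subr_le0 ltW.
  by rewrite -aL; have := mulr_ge0 ca s0; lra.
apply: le_trans (Phi_quarter_ge z0).
have s0' : 0 <= - s by lra.
have -> : z ^+ 2 = (a + - s) ^+ 2 / g by rewrite /z exprMn exprVn sgE.
apply: le_trans (@expRN_ge_craig _ n c L a (- s) g _ _ _ _ _ _ _ _ _) => //.
- apply: lerXn2r; rewrite ?nnegrE ?Phi_ge0 ?divr_ge0 ?expR_ge0//.
  by have := PhiN_le s0'; rewrite opprK.
- by rewrite lnE ler_piMr// /c1 lerBlDr; have := divr_gt0 w0 (pi_gt0 R); lra.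
Qed.

(** * The threshold on [n] *)

Lemma eventually_ln_ge (R : realType) (c M : R) : 0 < c ->
  exists nt : nat, forall n : nat, (nt <= n)%N ->
    0 < n%:R * c /\ M <= ln (n%:R * c).
Proof.
move=> c0; exists (Num.truncn (expR M / c)).+1 => n nt.
have h : expR M <= n%:R * c.
  rewrite -ler_pdivrMr// ltW//; apply: lt_le_trans (truncnS_gt _) _.
  by rewrite ler_nat.
have h0 : 0 < n%:R * c by apply: lt_le_trans h; rewrite expR_gt0.
by split=> //; rewrite -[leLHS]expRK ler_ln ?posrE ?expR_gt0.
Qed.

Lemma sigma2_gt0 (R : realType) (w : R) (n : nat) : 0 < w -> w < pi / 2 ->
  0 < ln (n%:R * c1 w) -> 0 < sigma2_ w n.
Proof.
move=> w0 wpi L0; have [_ c20] := c12_gt0 w0 wpi.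
have k := kappa_ge R; rewrite /sigma2_ (_ : - ln (ln 2) = kappa R)//.
have kp : 0 < kappa R by lra.
by rewrite divr_gt0// mulr_gt0 ?addr_gt0// mulr_gt0.
Qed.

Lemma eventually_Phi_expn_le (R : realType) (w : R) : 0 < w -> w < pi / 2 ->
  exists nt : nat, forall n : nat, (nt <= n)%N ->
    [/\ 1 < n%:R * c1 w, 0 < sigma2_ w n & forall s : R,
     Phi s%:E ^+ n <= Phi ((s + mu_ w n) / Num.sqrt (sigma2_ w n))%:E].
Proof.
move=> w0 wpi; have [c10 c20] := c12_gt0 w0 wpi.
(* One threshold meets both demands of [Phi_expn_le]: a logarithm of at least 10000 and of at least
   [c2 w]. *)
have [nt ntP] := eventually_ln_ge (100 * 100 + c2 w) c10.
exists nt => n /ntP[nc0 nL].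
have L0 : 0 < ln (n%:R * c1 w) by apply: lt_le_trans nL; lra.
split.
- by rewrite -ltr_ln ?posrE// ln1.
- exact: sigma2_gt0.
by move=> s; apply: Phi_expn_le => //; lra.
Qed.

(** * The Gaussian copula *)

(** The event is a difference of two sublevel sets of [Phi], whose masses are known by uniformity;
    the minima cover every position of [p] relative to the cell. *)
Lemma normal_prob_cell (R : realType) (c c' p : R) :
  0 <= c -> c <= c' -> c' <= 1 -> 0 <= p <= 1 ->
  normal_prob 0 1 [set u : R | Phi u%:E \in `]c, c'] /\ Phi u%:E <= p] =
  (Num.min c' p - Num.min c p)%:E.
Proof.
move=> c0 cc' c'1 /andP[p0 p1].
have mPhi : measurable_fun setT (fun u : R => Phi u%:E).
  by apply: continuous_measurable_fun; exact: continuous_Phi.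
have mle a : measurable [set u : R | Phi u%:E <= a].
  rewrite -[X in measurable X]setTI; apply: measurable_fun_le => //.
have -> : [set u : R | Phi u%:E \in `]c, c'] /\ Phi u%:E <= p] =
    [set u | Phi u%:E <= Num.min c' p] `\` [set u | Phi u%:E <= Num.min c p].
  apply/seteqP; split => u /=; rewrite in_itv/= !le_min.
    by move=> [/andP[cu ->] ->]; split=> //; rewrite leNgt cu.
  by move=> [/andP[-> pu]]; rewrite pu !andbT => /negP; rewrite -ltNge.
rewrite measureD; [|exact: mle|exact: mle|]; last first.
  by rewrite ltey_eq fin_num_measure//; exact: mle.
rewrite (_ : _ `&` _ = [set u : R | Phi u%:E <= Num.min c p]); last first.
  apply/setIidPr => u /=; rewrite !le_min => /andP[uc ->].
  by rewrite (le_trans uc).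
rewrite EFinB; congr (_ - _)%E; apply: normal_prob_Phi_le;
  rewrite le_min ge_min; apply/andP; split; lra.
Qed.

(** The product is built by integrating over the first coordinate; uniqueness of the product measure
    allows conditioning on the second, the independent component [v]. *)
Lemma product_measure_ysection (R : realType) (A : set (R * R)) : measurable A ->
  ((normal_prob (0 : R) 1 \x normal_prob (0 : R) 1) A =
   \int[normal_prob 0 1]_v normal_prob 0 1 (ysection A v))%E.
Proof.
move=> mA; rewrite (@product_measure_unique _ _ _ _ _ _ _
  (normal_prob 0 1 \x^ normal_prob 0 1)%E)// => B C mB mC.
exact: product_measure2E.
Qed.

Lemma measurable_gaussian_copula_map (R : realType) (a b : R) :
  measurable_fun setT
    (fun u : R * R => (Phi u.1%:E, Phi (a * u.1 + b * u.2)%:E)).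
Proof.
have mPhi : measurable_fun setT (fun u : R => Phi u%:E).
  by apply: continuous_measurable_fun; exact: continuous_Phi.
apply: measurable_fun_pair.
  exact: (measurableT_comp mPhi measurable_fst).
apply: (measurableT_comp mPhi); apply: measurable_funD.
  by apply: measurable_funM => //; exact: measurable_fst.
by apply: measurable_funM => //; exact: measurable_snd.
Qed.

Lemma gaussian_copulaE (R : realType) (rho : R) (A : set (R * R)) :
  measurable A ->
  (gaussian_copula rho A = \int[normal_prob 0 1]_v normal_prob 0 1
    [set u | A (Phi u%:E, Phi (rho * u + Num.sqrt (1 - rho ^+ 2) * v)%:E)])%E.
Proof.
move=> mA; set b := Num.sqrt _.
pose B : set (R * R) :=
  [set u | A (Phi u.1%:E, Phi (rho * u.1 + b * u.2)%:E)].
have mB : measurable B.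
  rewrite -[B]setTI; exact: (measurable_gaussian_copula_map rho b).
rewrite -[LHS]/((normal_prob (0 : R) 1 \x normal_prob (0 : R) 1)%E B).
rewrite product_measure_ysection//; apply: eq_integral => v _; congr (_ _).
by apply/seteqP; split => u; rewrite /ysection/= inE.
Qed.

Lemma gaussian_copula_left (R : realType) (rho c : R) : 0 <= c <= 1 ->
  gaussian_copula rho (`]c, +oo[ `*` setT) = (1 - c)%:E.
Proof.
move=> c01; rewrite gaussian_copulaE; last exact: measurableX.
rewrite (eq_integral (fun=> (1 - c)%:E)); last first.
  move=> v _; rewrite (_ : [set u | _] = ~` [set u : R | Phi u%:E <= c]).
    have mle : measurable [set u : R | Phi u%:E <= c].
      rewrite -[X in measurable X]setTI; apply: measurable_fun_le => //.
      by apply: continuous_measurable_fun; exact: continuous_Phi.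
    by rewrite probability_setC// [X in (1 - X)%E]normal_prob_Phi_le.
  apply/seteqP; split => u /=; rewrite in_itv/= andbT ltNge.
    by move=> [/negP].
  by move=> /negP.
rewrite integral_cst// -[RHS]mule1; congr (_ * _)%E.
exact: probability_setT.
Qed.

(* [p v] is the conditional probability of success given the independent
   component [v], on the scale of the first marginal. *)
Definition conditional_success (R : realType) (rho alpha : R) (p : R -> R) :=
  [/\ measurable_fun setT p, forall v, 0 <= p v <= 1,
   forall u v, (Phi (rho * u + Num.sqrt (1 - rho ^+ 2) * v)%:E <= alpha) =
     (Phi u%:E <= p v) &
   (\int[normal_prob 0 1]_v (p v)%:E)%E = alpha%:E].

Lemma conditional_success1 (R : realType) (rho : R) :
  conditional_success rho 1 (fun=> 1).
Proof.
split=> //.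
- by move=> v; rewrite ler01 lexx.
- by move=> u v; rewrite !Phi_le1.
- rewrite integral_cst// mul1e; exact: probability_setT.
Qed.

(** Since [rho > 0], the inequality [rho * u + b * v <= q] can be solved for [u]. The mean is
    [Phi q] because [rho ^+ 2 + b ^+ 2 = 1]. *)
Lemma conditional_success_Phi (R : realType) (rho q : R) : 0 < rho <= 1 ->
  conditional_success rho (Phi q%:E)
    (fun v => Phi ((q - Num.sqrt (1 - rho ^+ 2) * v) / rho)%:E).
Proof.
move=> /andP[r0 r1]; set b := Num.sqrt _; split.
- exact: measurable_fun_Phi_affine.
- by move=> v; rewrite Phi_ge0 Phi_le1.
- move=> u v; have mono x y : (Phi x%:E <= Phi y%:E :> R) = (x <= y).
    have [xy|xy] := leP x y; first by rewrite Phi_mono.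
    by apply/negbTE; rewrite -ltNge Phi_lt.
  by rewrite !mono ler_pdivlMr// lerBrDr mulrC.
- rewrite integral_Phi_affine// sqr_sqrtr ?subr_ge0 ?expr_le1// ?ltW//.
  by rewrite addrC subrK sqrtr1 divr1.
Qed.

Lemma gaussian_copula_right (R : realType) (rho alpha : R) (p : R -> R) :
  conditional_success rho alpha p ->
  gaussian_copula rho (setT `*` `]-oo, alpha]) = alpha%:E.
Proof.
move=> [_ p01 pE pint]; rewrite gaussian_copulaE; last exact: measurableX.
rewrite -pint; apply: eq_integral => v _; rewrite -normal_prob_Phi_le//.
congr (_ _); apply/seteqP; split => u /=; rewrite in_itv/= pE; first by case.
by [].
Qed.

Lemma gaussian_copula_cell (R : realType) (rho alpha : R) (p : R -> R) (c c' : R) :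
  conditional_success rho alpha p -> 0 <= c -> c <= c' -> c' <= 1 ->
  (gaussian_copula rho (`]c, c'] `*` `]-oo, alpha]) =
   \int[normal_prob 0 1]_v (Num.min c' (p v) - Num.min c (p v))%:E)%E.
Proof.
move=> [_ p01 pE _] c0 cc' c'1; rewrite gaussian_copulaE; last exact: measurableX.
apply: eq_integral => v _; rewrite -normal_prob_cell//; apply: congr1.
by apply/seteqP; split => u [/= uc]; rewrite ?in_itv/= ?pE.
Qed.

Lemma expr_diff_le (R : realFieldType) (x y : R) (n : nat) :
  0 <= y -> y <= x ->
  x ^+ n - y ^+ n <= n%:R * (x - y) * x ^+ n.-1.
Proof.
move=> y0 yx; have x0 : 0 <= x by lra.
rewrite subrXX [n%:R * _]mulrC -mulrA ler_wpM2l ?subr_ge0//.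
rewrite mulr_natl -[X in _ *+ X]card_ord -sumr_const ler_sum// => i _.
have -> : x ^+ n.-1 = x ^+ (n.-1 - i) * x ^+ i.
  by rewrite -exprD subnK// -ltnS prednK// (leq_ltn_trans _ (ltn_ord i)).
rewrite (_ : n.-1 - i = n - i.+1)%N; last by rewrite -subn1 -subnDA add1n.
by rewrite ler_wpM2l ?exprn_ge0// lerXn2r// nnegrE.
Qed.

(* The sum is a Riemann sum of n (1 - c)^(n-1) over [0, p]; the error telescopes. *)
Lemma riemann_min_ge (R : realFieldType) (p : R) (n N : nat) :
  0 <= p <= 1 -> forall c : nat -> R, (forall i, c i = i%:R / N.+1%:R) ->
  1 - (1 - p) ^+ n <= n%:R / N.+1%:R +
   n%:R * \sum_(i < N.+1)
     (Num.min (c i.+1) p - Num.min (c i) p) * (1 - c i.+1) ^+ n.-1.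
Proof.
move=> /andP[p0 p1] c cE.
have N0 : 0 < N.+1%:R :> R by [].
pose x i := Num.min (c i) p.
have cS i : c i.+1 - c i = N.+1%:R^-1 by rewrite !cE -mulrBl -natrB// subSnn mul1r.
have c0 i : 0 <= c i by rewrite cE divr_ge0.
have c1 (i : 'I_N.+1) : c i.+1 <= 1 by rewrite cE ler_pdivrMr// mul1r ler_nat.
have tele (f : nat -> R) : \sum_(i < N.+1) (f i - f i.+1) = f 0%N - f N.+1.
  have := telescope_sumr f (leq0n N.+1).
  rewrite big_mkord => h; rewrite -[RHS]opprB -h -sumrN.
  by apply: eq_bigr => i _; rewrite opprB.
(* On one cell [expr_diff_le] gives the factor [(1 - c i) ^+ n.-1]; moving it to the right endpoint
   costs at most [n] times the mesh times its drop over the cell. *)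
have step (i : 'I_N.+1) : (1 - x i) ^+ n - (1 - x i.+1) ^+ n <=
    n%:R / N.+1%:R * ((1 - c i) ^+ n.-1 - (1 - c i.+1) ^+ n.-1) +
    n%:R * ((x i.+1 - x i) * (1 - c i.+1) ^+ n.-1).
  have cc : c i <= c i.+1 by rewrite -subr_ge0 cS invr_ge0.
  have D0 : 0 <= (1 - c i) ^+ n.-1 - (1 - c i.+1) ^+ n.-1.
    have h1 : 0 <= 1 - c i.+1 by rewrite subr_ge0.
    have h2 : 1 - c i.+1 <= 1 - c i by rewrite lerD2l lerN2.
    by rewrite subr_ge0 lerXn2r ?nnegrE//; exact: le_trans h2.
  rewrite /x; have [pc|cp] := leP p (c i).
    rewrite (min_r (le_trans pc cc)) !subrr mul0r mulr0 addr0.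
    by rewrite mulr_ge0// divr_ge0.
  set y := Num.min _ _.
  have cy : c i <= y by rewrite le_min cc ltW.
  have yc : y <= c i.+1 by rewrite ge_min lexx.
  have y1 : y <= 1 by exact: le_trans (c1 i).
  have := @expr_diff_le _ (1 - c i) (1 - y) n.
  have -> : 1 - c i - (1 - y) = y - c i by ring.
  move=> /(_ _ _) h; apply: le_trans (h _ _) _; [by lra|by lra|].
  have yN : y - c i <= N.+1%:R^-1 by rewrite -(cS i) lerD2r.
  have n0 : 0 <= n%:R :> R by [].
  have := ler_wpM2l n0 (ler_wpM2r D0 yN).
  move: (_ ^+ n.-1) (_ ^+ n.-1) (N.+1%:R^-1) (n%:R) => A B q r *; lra.
have := ler_sum (index_enum 'I_N.+1) (P := xpredT) (fun i _ => step i).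
rewrite (tele (fun i => (1 - x i) ^+ n)) big_split/= -!mulr_sumr.
rewrite (tele (fun i => (1 - c i) ^+ n.-1)).
have -> : x 0%N = 0 by rewrite /x cE mul0r min_l.
have -> : x N.+1 = p by rewrite /x cE divff ?gt_eqF// min_r.
rewrite !cE divff ?gt_eqF// subrr mul0r subr0 !expr1n => h; apply: le_trans h _.
rewrite lerD2r ler_piMr ?divr_ge0// gerBl exprn_ge0//.
Qed.

(** * Lower bound for the success probability *)

Section CopulaEvents.
Context d (T : measurableType d) (R : realType) (P : probability T R).
Context (Z X : {RV P >-> R}) (rho alpha : R) (xstar : \bar R) (p : R -> R).
Hypotheses (ZX : has_copula Z X (gaussian_copula rho))
  (Xstar : P [set w | ((X w)%:E <= xstar)%E] = alpha%:E)
  (cp : conditional_success rho alpha p).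

Let FZ (z : R) : R := fine (cdf Z z).
Let FX (x : R) : R := fine (cdf X x).

Lemma fin_num_cdf (Y : {RV P >-> R}) (y : R) : cdf Y y \is a fin_num.
Proof. by rewrite /cdf fin_num_measure. Qed.

Lemma fine_cdf_mono (Y : {RV P >-> R}) (x y : R) :
  x <= y -> fine (cdf Y x) <= fine (cdf Y y).
Proof.
move=> xy; apply: fine_le; rewrite ?fin_num_cdf//.
exact: cdf_nondecreasing.
Qed.

Lemma measurable_fine_cdf (Y : {RV P >-> R}) :
  measurable_fun setT (fun y : R => fine (cdf Y y)).
Proof. by apply: nondecreasing_measurable => //; exact: fine_cdf_mono. Qed.

Lemma measurable_xstar : measurable [set x : R | (x%:E <= xstar)%E].
Proof.
rewrite -[X in measurable X]setTI; apply: emeasurable_fun_infty_c => //.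
Qed.

Lemma measurable_RV_preimage (Y : {RV P >-> R}) (A : set R) :
  measurable A -> measurable [set w | A (Y w)].
Proof.
by move=> mA; rewrite -[X in measurable X]setTI; exact: measurable_funPT.
Qed.

Lemma le_xstar_FX x : (x%:E <= xstar)%E -> FX x <= alpha.
Proof.
move=> xx; rewrite /FX -lee_fin fineK ?fin_num_cdf// -Xstar.
rewrite /cdf /distribution /pushforward.
apply: (le_measure P); rewrite ?inE.
- exact: measurable_RV_preimage.
- exact: (measurable_RV_preimage X measurable_xstar).
move=> w /=; rewrite in_itv/= => Xw; apply: le_trans xx; by rewrite lee_fin.
Qed.

Lemma measurable_FX_le : measurable [set w | FX (X w) <= alpha].
Proof.
apply: (measurable_RV_preimage X (A := [set x | FX x <= alpha])).
rewrite -[X in measurable X]setTI; apply: measurable_fun_le => //.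
exact: measurable_fine_cdf.
Qed.

(* X <= xstar implies F_X(X) <= alpha and both events have probability alpha. *)
Lemma FX_le_xstar_null :
  P ([set w | FX (X w) <= alpha] `\` [set w | ((X w)%:E <= xstar)%E]) = 0%E.
Proof.
have mS := measurable_RV_preimage X measurable_xstar.
rewrite measureD//; last 2 first.
- exact: measurable_FX_le.
- by rewrite ltey_eq fin_num_measure//; exact: measurable_FX_le.
rewrite (_ : _ `&` _ = [set w | ((X w)%:E <= xstar)%E]); last first.
  by apply/setIidPr => w /= /le_xstar_FX.
have e : P [set w | FX (X w) <= alpha] = alpha%:E.
  rewrite -(gaussian_copula_right cp) -ZX; last exact: measurableX.
  by congr (P _); apply/seteqP; split => w /=; rewrite in_itv/=; [|case].
transitivity (alpha%:E - alpha%:E)%E; last by rewrite subee.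
by congr (_ - _)%E; [exact: e|exact: Xstar].
Qed.

(** The copula describes the event with [FX (X w) <= alpha]; passing to [xstar] changes it by a null
    set only. *)
Lemma prob_cell (c c' : R) : 0 <= c -> c <= c' -> c' <= 1 ->
  P [set w | FZ (Z w) \in `]c, c'] /\ ((X w)%:E <= xstar)%E] =
  (\int[normal_prob 0 1]_v (Num.min c' (p v) - Num.min c (p v))%:E)%E.
Proof.
move=> c0 cc' c'1; rewrite -(gaussian_copula_cell cp)// -ZX;
  last exact: measurableX.
set E := [set w | _ /\ _]; set E1 := (X in _ = P X).
have mS := measurable_RV_preimage X measurable_xstar.
have mZ : measurable [set w | FZ (Z w) \in `]c, c']].
  apply: (measurable_RV_preimage Z (A := [set z | FZ z \in `]c, c']])).
  rewrite -[X in measurable X]setTI.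
  have h := @measurable_fine_cdf Z measurableT _ (measurable_itv `]c, c']).
  exact: h.
have E1E : E1 = [set w | FZ (Z w) \in `]c, c']] `&` [set w | FX (X w) <= alpha].
  by apply/seteqP; split => w [/= wc wx]; split=> //=; move: wx; rewrite /= in_itv.
have mE1 : measurable E1.
  by rewrite E1E; apply: measurableI => //; exact: measurable_FX_le.
transitivity (P (E1 `\` [set w | ((X w)%:E <= xstar)%E]) +
    P (E1 `&` [set w | ((X w)%:E <= xstar)%E]))%E; last exact/esym/measureDI.
have -> : P (E1 `\` [set w | ((X w)%:E <= xstar)%E]) = 0%E.
  apply: subset_measure0 FX_le_xstar_null.
  - exact: measurableD.
  - by apply: measurableD => //; exact: measurable_FX_le.
  - by rewrite E1E => w [[]].
rewrite add0e.
congr (P _); apply/seteqP; split => w; rewrite E1E /E/=.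
  by move=> [wc wx]; split=> //; split=> //; exact: le_xstar_FX.
by move=> [[]].
Qed.

Lemma prob_above (c : R) : 0 <= c <= 1 -> P [set w | c < FZ (Z w)] = (1 - c)%:E.
Proof.
move=> c01; rewrite -(gaussian_copula_left rho c01) -ZX; last exact: measurableX.
by congr (P _); apply/seteqP; split => w /=; rewrite in_itv/= andbT; [|case].
Qed.

End CopulaEvents.

(** * Measurability and monotonicity of the success event *)

(** The order depends on [w] only through the finite table of comparisons [r w], so the event is a
    finite union over tables. *)
Lemma measurable_z_order d (T : measurableType d) (R : realType)
    (P : probability T R) (n : nat) (Zs : 'I_n -> {RV P >-> R})
    (S : seq 'I_n -> set T) :
  (forall s, measurable (S s)) -> measurable [set w | S (z_order Zs w) w].
Proof.
move=> mS.
pose r (w : T) : {ffun 'I_n * 'I_n -> bool} := [ffun q => Zs q.1 w <= Zs q.2 w].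
pose so (f : {ffun 'I_n * 'I_n -> bool}) := sort (fun j k => f (j, k)) (enum 'I_n).
have zE w : z_order Zs w = so (r w).
  rewrite /z_order /so; congr sort.
  by apply/funext => j; apply/funext => k; rewrite ffunE.
rewrite (_ : [set w | _] = \bigcup_f ([set w | r w = f] `&` S (so f))); last first.
  apply/seteqP; split => w /=; first by rewrite zE => h; exists (r w).
  by move=> [f _ [/= <-]]; rewrite -zE.
apply: fin_bigcup_measurable; first exact: finite_finset.
move=> f _; apply: measurableI => //.
rewrite (_ : [set w | _] =
    \bigcap_q [set w | (Zs q.1 w <= Zs q.2 w) = f q]); last first.
  apply/seteqP; split => w /=.
    by move=> <- q _ /=; rewrite ffunE.
  by move=> h; apply/ffunP => q; rewrite ffunE h.
apply: fin_bigcap_measurable; first exact: finite_finset.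
move=> q _.
have mle : measurable [set w | Zs q.1 w <= Zs q.2 w].
  by rewrite -[X in measurable X]setTI; exact: measurable_fun_le.
case: (f q); first exact: mle.
rewrite (_ : [set w | _] = ~` [set w | Zs q.1 w <= Zs q.2 w]).
  exact: measurableC.
by apply/seteqP; split => w /=; [move=> ->|move=> /negP/negbTE].
Qed.

Lemma measurable_success d (T : measurableType d) (R : realType)
    (P : probability T R) (n : nat) (Zs Xs : 'I_n -> {RV P >-> R}) (m : nat)
    (xstar : \bar R) :
  measurable [set w |
    (\big[Order.min/+oo]_(i < m) (concomitant Zs Xs i w)%:E <= xstar)%E].
Proof.
apply: (@measurable_z_order _ _ _ _ _ Zs (fun s => [set w |
  (\big[Order.min/+oo]_(i < m) (nth 0 [seq Xs k w | k <- s] i)%:E <= xstar)%E])).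
move=> s; rewrite -[X in measurable X]setTI.
apply: emeasurable_fun_infty_c => //.
elim: m => [|m IH].
  by under eq_fun do rewrite big_ord0; exact: measurable_cst.
under eq_fun do rewrite big_ord_recr/=.
apply: measurable_mine => //; apply/measurable_EFinP.
have [ms|sm] := ltnP m (size s).
  case: s {IH} ms => // k0 s ms.
  rewrite (_ : (fun _ => _) = Xs (nth k0 (k0 :: s) m)); last first.
    by apply/funext => w; rewrite (nth_map k0).
  by [].
(* Past the end of [s], [nth] returns its default value 0. *)
rewrite (_ : (fun _ => _) = cst 0); first exact: measurable_cst.
by apply/funext => w; rewrite nth_default// size_map.
Qed.

Lemma p_success_mono d (T : measurableType d) (R : realType)
    (P : probability T R) (n : nat) (Zs Xs : 'I_n -> {RV P >-> R}) (m : nat)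
    (xstar : \bar R) : (1 <= m)%N ->
  (p_success Zs Xs 1 xstar <= p_success Zs Xs m xstar)%E.
Proof.
case: m => // m _; apply: le_measure; rewrite ?inE;
  [exact: measurable_success|exact: measurable_success|].
move=> w /=; rewrite big_ord1; apply: le_trans.
by rewrite big_ord_recl ge_min lexx.
Qed.

(** Sorting puts at the head a value at most [Zs k w], which strictness permits for [k] only. *)
Lemma z_order_head d (T : measurableType d) (R : realType)
    (P : probability T R) (n : nat) (Zs : 'I_n -> {RV P >-> R}) (w : T)
    (k : 'I_n) :
  (forall j, j != k -> Zs k w < Zs j w) -> exists s, z_order Zs w = k :: s.
Proof.
move=> kmin.
have tot : total (fun i j => Zs i w <= Zs j w) by move=> i j; exact: le_total.
have tr : transitive (fun i j => Zs i w <= Zs j w).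
  by move=> i j l; exact: le_trans.
have := sort_sorted tot (enum 'I_n); rewrite -/(z_order Zs w).
have : k \in z_order Zs w by rewrite mem_sort mem_enum.
case: (z_order Zs w) => // h s; rewrite inE => /predU1P[->|ks]; first by exists s.
move=> /=; rewrite path_sortedE// => /andP[/allP/(_ _ ks) hk _].
have [->|hk'] := eqVneq h k; first by exists s.
by move: (kmin _ hk'); rewrite ltNge hk.
Qed.

Section SuccessLowerBound.
Context d (T : measurableType d) (R : realType) (P : probability T R).
Context (Z X : {RV P >-> R}) (rho alpha : R) (xstar : \bar R) (p : R -> R).
Context (n N : nat) (Zs Xs : 'I_n -> {RV P >-> R}).
Hypotheses (ZX : has_copula Z X (gaussian_copula rho))
  (iid : iid_copies Z X Zs Xs)
  (Xstar : P [set w | ((X w)%:E <= xstar)%E] = alpha%:E)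
  (cp : conditional_success rho alpha p).

Let FZ (z : R) : R := fine (cdf Z z).
Let c (i : nat) : R := i%:R / N.+1%:R.

Let c_ge0 i : 0 <= c i. Proof. by rewrite divr_ge0. Qed.

Let c_le i : c i <= c i.+1.
Proof. by rewrite ler_wpM2r ?invr_ge0// ler_nat. Qed.

Let c_le1 (i : 'I_N.+1) : c i.+1 <= 1.
Proof. by rewrite ler_pdivrMr// mul1r ler_nat. Qed.

(* On the event [q = (k, i)], the value [F_Z(Z_k)] lies in the i-th cell and
   all other values lie above that cell. *)
Let A (q : 'I_n * 'I_N.+1) (j : 'I_n) : set (R * R) :=
  if j == q.1 then [set z | FZ z.1 \in `]c q.2, c q.2.+1] /\ (z.2%:E <= xstar)%E]
  else [set z | c q.2.+1 < FZ z.1].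

Let F (q : 'I_n * 'I_N.+1) : set T :=
  [set w | forall j, j \in [set: 'I_n]%SET -> A q j (Zs j w, Xs j w)].

Let measurable_FZ_fst (B : set R) : measurable B ->
  measurable [set z : R * R | B (FZ z.1)].
Proof.
move=> mB; rewrite -[X in measurable X]setTI.
exact: (measurableT_comp (measurable_fine_cdf Z) measurable_fst).
Qed.

Let measurable_A q j : measurable (A q j).
Proof.
rewrite /A; case: ifP => _; last first.
  have := measurable_FZ_fst (measurable_itv `]c q.2.+1, +oo[).
  by congr measurable; apply/seteqP; split => z /=; rewrite in_itv/= andbT.
apply: (@measurableI _ _ [set z : R * R | FZ z.1 \in `]c q.2, c q.2.+1]]
  [set z : R * R | (z.2%:E <= xstar)%E]).
  exact: measurable_FZ_fst (measurable_itv `]c q.2, c q.2.+1]).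
rewrite -[X in measurable X]setTI.
exact: (measurable_snd measurableT _ (measurable_xstar xstar)).
Qed.

Let measurable_F q : measurable (F q).
Proof.
rewrite (_ : F q = \bigcap_j [set w | A q j (Zs j w, Xs j w)]).
  apply: fin_bigcap_measurable; first exact: finite_finset.
  move=> j _; rewrite -[X in measurable X]setTI.
  have m : measurable_fun setT (fun w => (Zs j w, Xs j w)).
    by apply: measurable_fun_pair.
  exact: m.
apply/seteqP; split => w /= h j _; last exact: h.
by apply: h; rewrite finset.in_setT.
Qed.

(** Independence gives one factor from the cell of the observation [q.1] and [n.-1] equal factors
    from the others. *)
Let prob_F q : P (F q) = (\int[normal_prob 0 1]_v
  ((Num.min (c q.2.+1) (p v) - Num.min (c q.2) (p v)) *
   (1 - c q.2.+1) ^+ n.-1)%:E)%E.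
Proof.
have [mp p01 _ _] := cp.
rewrite iid.2//.
transitivity (\prod_(j in [set: 'I_n]%SET) (if j == q.1 then
   \int[normal_prob 0 1]_v (Num.min (c q.2.+1) (p v) - Num.min (c q.2) (p v))%:E
   else (1 - c q.2.+1)%:E))%E.
  apply: eq_bigr => j _; rewrite iid.1// /A; case: ifP => _.
    by rewrite -(prob_cell ZX Xstar cp).
  by rewrite -(prob_above ZX) // c_ge0 c_le1.
rewrite (bigD1 q.1) ?finset.in_setT//= eqxx.
rewrite (eq_bigr (fun=> (1 - c q.2.+1)%:E)); last by move=> j /andP[_ /negbTE->].
rewrite big_const (eq_card (B := predC1 q.1)); last first.
  by move=> j; rewrite -!topredE/= finset.in_setT.
rewrite cardC1 card_ord.
have -> m : iter m ( *%E (1 - c q.2.+1)%:E) 1%E = ((1 - c q.2.+1) ^+ m)%:E.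
  by elim: m => //= m ->; rewrite -EFinM exprS.
rewrite -ge0_integralZr//.
- apply/measurable_EFinP; apply: measurable_funB; exact: measurable_minr.
- by move=> v _; rewrite lee_fin subr_ge0 le_min2.
- by rewrite lee_fin exprn_ge0// subr_ge0.
Qed.

Let F_own q w : F q w -> [/\ c q.2 < FZ (Zs q.1 w),
  FZ (Zs q.1 w) <= c q.2.+1 & ((Xs q.1 w)%:E <= xstar)%E].
Proof.
move=> /(_ q.1 (finset.in_setT _)); rewrite /A eqxx => -[/= + Xk].
by rewrite in_itv/= => /andP[].
Qed.

Let F_other q w j : F q w -> j != q.1 -> c q.2.+1 < FZ (Zs j w).
Proof.
by move=> /(_ j (finset.in_setT _)); rewrite /A => + /negbTE jq; rewrite jq.
Qed.

Let c_lt i j : c i < c j -> (i < j)%N.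
Proof. by rewrite /c ltr_pM2r ?invr_gt0// ltr_nat. Qed.

(** For distinct observations the upper end of each cell would lie strictly below that of the other;
    for the same observation, distinct cells are disjoint. *)
Let trivIset_F : trivIset setT F.
Proof.
apply/trivIsetP => -[k i] [k' i'] _ _ ne; rewrite -subset0 => w [] /= Fk Fk'.
have [/= k1 k2 _] := F_own Fk; have [/= k1' k2' _] := F_own Fk'.
have [kk|kk] := eqVneq k k'; last first.
  have /= o := F_other Fk; have /= o' := F_other Fk'.
  have h' := o k'; rewrite eq_sym in h'.
  have := lt_le_trans (h' kk) k2'; have := lt_le_trans (o' k kk) k2.
  by move=> h1 h2; have := lt_trans h1 h2; rewrite ltxx.
subst k'; case/negP: ne; rewrite xpair_eqE eqxx/= -val_eqE/= eqn_leq.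
by rewrite -ltnS (c_lt (lt_le_trans k1 k2')) -ltnS (c_lt (lt_le_trans k1' k2)).
Qed.

(** As [FZ] is monotone, a strictly smaller value of [FZ] forces a strictly smaller [Z], so
    observation [k] is the strict minimum and comes first in the order. *)
Let F_success q : F q `<=` [set w |
  (\big[Order.min/+oo]_(i < 1) (concomitant Zs Xs i w)%:E <= xstar)%E].
Proof.
case: q => k i w Fw; rewrite /= big_ord1 /concomitant.
have [/= _ ck Xk] := F_own Fw.
have kmin j : j != k -> Zs k w < Zs j w.
  move=> jk; have /= cj := F_other Fw jk.
  rewrite ltNge; apply/negP => /(fine_cdf_mono Z).
  by rewrite leNgt (le_lt_trans ck).
by have [s ->] := z_order_head kmin.
Qed.

(** The disjoint events [F q] lie inside the success event, and their probabilities add up to the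
    integral of a Riemann sum, whose deficit [riemann_min_ge] controls. *)
Lemma p_success1_ge_approx :
  (\int[normal_prob 0 1]_v (1 - (1 - p v) ^+ n)%:E <=
   p_success Zs Xs 1 xstar + (n%:R / N.+1%:R)%:E)%E.
Proof.
have [mp p01 _ _] := cp.
pose g (q : 'I_n * 'I_N.+1) (v : R) :=
  (Num.min (c q.2.+1) (p v) - Num.min (c q.2) (p v)) * (1 - c q.2.+1) ^+ n.-1.
have g0 q v : 0 <= g q v.
  by rewrite mulr_ge0 ?exprn_ge0 ?subr_ge0 ?le_min2.
have mg q : measurable_fun setT (g q).
  by apply: measurable_funM => //; apply: measurable_funB; exact: measurable_minr.
have le1 : (\int[normal_prob 0 1]_v (\sum_q g q v)%:E <= p_success Zs Xs 1 xstar)%E.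
  under eq_integral do rewrite -sumEFin.
  rewrite ge0_integral_sum//; last 2 first.
  - by move=> q; apply/measurable_EFinP; exact: mg.
  - by move=> q v _; rewrite lee_fin.
  under eq_bigr do rewrite -prob_F.
  rewrite (fsbig_seq _ _ (index_enum_uniq _))/= -measure_fin_bigcup//.
    apply: le_measure; rewrite ?inE.
    - exact: fin_bigcup_measurable.
    - exact: measurable_success.
    - by apply: bigcup_sub => q _; exact: F_success.
  exact: sub_trivIset trivIset_F.
have msum : measurable_fun setT (fun v => \sum_q g q v).
  exact: measurable_sum.
have sum0 v : 0 <= \sum_q g q v by rewrite sumr_ge0.
apply: (@le_trans _ _ (\int[normal_prob 0 1]_v
    ((n%:R / N.+1%:R)%:E + (\sum_q g q v)%:E))%E).
  apply: ge0_le_integral => //.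
  - move=> v _; have /andP[pv0 pv1] := p01 v.
    by rewrite lee_fin subr_ge0 exprn_ile1//; lra.
  - apply/measurable_EFinP; apply: measurable_funB => //.
    by apply: measurable_funX; exact: measurable_funB.
  - by apply: emeasurable_funD => //; exact/measurable_EFinP.
  - move=> v _; rewrite -EFinD lee_fin.
    apply: le_trans (riemann_min_ge n (p01 v) (c := c) (fun=> erefl)) _.
    rewrite lerD2l [leRHS](_ : _ = \sum_(k < n) \sum_(i < N.+1)
        (Num.min (c i.+1) (p v) - Num.min (c i) (p v)) * (1 - c i.+1) ^+ n.-1).
      by rewrite sumr_const card_ord mulr_natl.
    by rewrite pair_bigA; apply: eq_bigr => -[].
rewrite ge0_integralD//; last 2 first.
- by move=> v _; rewrite lee_fin.
- exact/measurable_EFinP.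
rewrite integral_cst// [X in (_ * X + _)%E]probability_setT mule1 addeC.
by rewrite leeD2r.
Qed.

End SuccessLowerBound.

(** The integrand is the probability that the least of [n] independent uniform variables is at most
    [p v]. The grid is refined until the discretization error is at most [e]. *)
Lemma p_success1_ge_integral d (T : measurableType d) (R : realType)
    (P : probability T R) (Z X : {RV P >-> R}) (rho alpha : R)
    (xstar : \bar R) (p : R -> R) (n : nat) (Zs Xs : 'I_n -> {RV P >-> R}) :
  has_copula Z X (gaussian_copula rho) -> iid_copies Z X Zs Xs ->
  P [set w | ((X w)%:E <= xstar)%E] = alpha%:E ->
  conditional_success rho alpha p ->
  (\int[normal_prob 0 1]_v (1 - (1 - p v) ^+ n)%:E <= p_success Zs Xs 1 xstar)%E.
Proof.
move=> ZX iid Xstar cp; apply/lee_addgt0Pr => e e0.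
have h := @p_success1_ge_approx _ _ _ _ _ _ _ _ _ _ n
  (Num.truncn (n%:R / e)) _ _ ZX iid Xstar cp.
apply: le_trans h _; rewrite leeD2l// lee_fin ler_pdivrMr// mulrC -ler_pdivrMr//.
by rewrite ltW// truncnS_gt.
Qed.

(* The mixture of the tails of [normal_prob (mu_ w n) (sqrt sigma2_)] is again a
   Gaussian tail, which gives the closed form of the lower bound. *)
Lemma Phi_le_integral_success (R : realType) (w rho q : R) (n : nat) :
  0 < rho <= 1 -> 0 < sigma2_ w n ->
  (forall s : R, Phi s%:E ^+ n <=
     Phi ((s + mu_ w n) / Num.sqrt (sigma2_ w n))%:E) ->
  ((Phi ((q - rho * mu_ w n) /
     Num.sqrt (1 - rho ^+ 2 + rho ^+ 2 * sigma2_ w n))%:E)%:E <=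
   \int[normal_prob 0 1]_v
     (1 - (1 - Phi ((q - Num.sqrt (1 - rho ^+ 2) * v) / rho)%:E) ^+ n)%:E)%E.
Proof.
move=> /andP[r0 r1] s20 key; set b := Num.sqrt (1 - rho ^+ 2).
have sg0 : 0 < Num.sqrt (sigma2_ w n) by rewrite sqrtr_gt0.
have sE : 1 - rho ^+ 2 + rho ^+ 2 * sigma2_ w n =
    (rho * Num.sqrt (sigma2_ w n)) ^+ 2 + b ^+ 2.
  rewrite exprMn !sqr_sqrtr ?(ltW s20)// ?subr_ge0 ?expr_le1// ?ltW//.
  by rewrite addrC.
rewrite sE -integral_Phi_affine ?mulr_gt0//.
have m1 := measurable_fun_Phi_affine rho b q.
apply: ge0_le_integral => //.
- by move=> v _; rewrite lee_fin Phi_ge0.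
- by apply/measurable_EFinP; exact: measurable_fun_Phi_affine.
- apply/measurable_EFinP; apply: measurable_funB => //.
  by apply: measurable_funX; exact: measurable_funB.
(* As [1 - Phi y = Phi (- y)], the domination is used at [- y]. *)
move=> v _; rewrite lee_fin -PhiN.
set y := (q - b * v) / rho.
have := key (- y); set sg := Num.sqrt (sigma2_ w n).
have -> : (- y + mu_ w n) / sg = - ((q - rho * mu_ w n - b * v) / (rho * sg)).
  by rewrite /y; field; rewrite !gt_eqF.
rewrite [in X in _ <= X -> _]PhiN; lra.
Qed.

Unset Implicit Arguments.

Theorem theorem4p1 (R : realType) (omega : R)
    (omega_gt0 : 0 < omega) (omega_lt : omega < pi / 2) :
  exists nt : nat, forall n : nat, (nt <= n)%N ->
    1 < n%:R * c1 omega /\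
    forall (m : nat) (rho alpha : R), (1 <= m <= n)%N ->
      0 < rho <= 1 -> 0 < alpha <= 1 ->
    forall (d : measure_display) (T : measurableType d) (P : probability T R)
      (Z X : {RV P >-> R}) (Zs Xs : 'I_n -> {RV P >-> R}) (xstar : \bar R),
      continuous_joint_cdf Z X ->
      has_copula Z X (gaussian_copula rho) ->
      iid_copies Z X Zs Xs ->
      P [set w | ((X w)%:E <= xstar)%E] = alpha%:E ->
      (p_success Zs Xs m xstar >= p_success Zs Xs 1 xstar)%E /\
      (p_success Zs Xs 1 xstar >=
       (Phi ((PhiInv alpha - (rho * mu_ omega n)%:E) *
             (Num.sqrt (1 - rho ^+ 2 + rho ^+ 2 * sigma2_ omega n))^-1%:E))%:E)%E.
Proof.
have [nt ntP] := eventually_Phi_expn_le omega_gt0 omega_lt.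
exists nt => n /ntP[nc s20 key]; split=> //.
move=> m rho alpha /andP[m1 mn] rho01 /andP[al0 al1] d T P Z X Zs Xs xstar _.
move=> ZX iid Xstar; split; first exact: p_success_mono.
have [r0 r1] := andP rho01.
have s0 : 0 < Num.sqrt (1 - rho ^+ 2 + rho ^+ 2 * sigma2_ omega n).
  have h1 : 0 <= 1 - rho ^+ 2 by rewrite subr_ge0 expr_le1// ltW.
  have h2 : 0 < rho ^+ 2 * sigma2_ omega n.
    by apply: mulr_gt0 => //; exact: exprn_gt0.
  by rewrite sqrtr_gt0 ltr_wpDl.
move: al1 Xstar; rewrite le_eqVlt => /predU1P[->|al1] Xstar.
  (* For [alpha = 1] the quantile is infinite and the bound is 1; the integral equals 1 because
     [0 ^+ n] vanishes for [n > 0]. *)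
  rewrite PhiInv1 addye// gt0_mulye ?lte_fin ?invr_gt0// Phi_pinfty.
  apply: le_trans (p_success1_ge_integral ZX iid Xstar (conditional_success1 rho)).
  have n0 : (0 < n)%N by exact: leq_trans m1 mn.
  rewrite subrr expr0n gtn_eqF//= subr0 integral_cst//.
  by rewrite [X in (_ * X)%E]probability_setT mule1.
have [q -> qal] : exists2 q : R, PhiInv alpha = q%:E & Phi q%:E = alpha.
  by apply: PhiInv_lt1; rewrite al0.
have cp := conditional_success_Phi q rho01; rewrite qal in cp.
apply: le_trans (p_success1_ge_integral ZX iid Xstar cp).
exact: Phi_le_integral_success.
Qed.
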